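(* Let $\Sigma_{\mathbb{R}P^2}$ and $\Sigma_{\mathbb{C}P^2}$ denote the minimal triangulations of $\mathbb{R}P^2$ and $\mathbb{C}P^2$, respectively. Given any almost-embedding $\Sigma_{\mathbb{R}P^2}\to\mathbb{R}^4$, there is no homotopy to its mirror image through almost-embeddings. The same is true for any almost-embedding $\Sigma_{\mathbb{C}P^2}\to\mathbb{R}^7$. That is, $$\mathrm{coind}(\mathrm{AEmb}_1(\Sigma_{\mathbb{R}P^2},\mathbb{R}^4)) = 0 \quad\text{and}\quad \mathrm{coind}(\mathrm{AEmb}_1(\Sigma_{\mathbb{C}P^2},\mathbb{R}^7)) = 0.$$
   Context: $\Sigma_{\mathbb{R}P^2}$ is the unique 6-vertex simplicial complex triangulating $\mathbb{R}P^2$ (the antipodal quotient of the boundary of the icosahedron). $\Sigma_{\mathbb{C}P^2}$ is the unique 9-vertex simplicial complex triangulating $\mathbb{C}P^2$ (Kühnel's triangulation). Each has the property that for every bipartition of its vertex set precisely one of the two parts is a face (Arnoux–Marin). For a simplicial complex $\Sigma$, a continuous map $f$ from (the geometric realization of) $\Sigma$ to $\mathbb{R}^d$ is an almost-embedding if $f(\sigma)\cap f(\tau)=\emptyset$ for any two vertex-disjoint faces $\sigma,\tau$ of $\Sigma$. $\mathrm{AEmb}(\Sigma,\mathbb{R}^d)$ is the space of almost-embeddings with the compact-open topology. $\mathrm{AEmb}_1(\Sigma,\mathbb{R}^d)$ is this space with the $\mathbb{Z}/2$-action whose generator $\varepsilon$ acts by $(\varepsilon\cdot f)(x)=\varepsilon\cdot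 f(x)$, where $\varepsilon\cdot(x_1,x_2,\dots,x_d)=(-x_1,x_2,\dots,x_d)$. A mirror image of a map $f$ into $\mathbb{R}^d$ is a map $h\circ f$ with $h\colon\mathbb{R}^d\to\mathbb{R}^d$ an orientation-reversing homeomorphism (for instance the reflection $\varepsilon$). A homotopy through almost-embeddings is a homotopy $f_t$, $t\in[0,1]$, with every $f_t$ an almost-embedding. The coindex $\mathrm{coind}(Y)$ of a $\mathbb{Z}/2$-space $Y$ is the largest integer $k$ such that there is a continuous $\mathbb{Z}/2$-equivariant map $S^k\to Y$, where $S^k$ carries the antipodal action; by convention $S^{-1}=\emptyset$, so $\mathrm{coind}(\emptyset)=-1$. *)

(* Defs.v *)
From HB Require Import structures.
From mathcomp Require Import all_boot all_order all_algebra.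
From mathcomp Require Import all_classical all_reals all_analysis.

Set Implicit Arguments.
Unset Strict Implicit.
Unset Printing Implicit Defensive.

Import Order.TTheory GRing.Theory Num.Theory.
Import numFieldNormedType.Exports.

Local Open Scope classical_set_scope.
Local Open Scope ring_scope.

(* The empty set counts as a face. *)
Record simplicial_complex (n : nat) := SimplicialComplex {
  faces :> {set {set 'I_n}};
  faces_closed : forall s t : {set 'I_n}, t \subset s -> s \in faces -> t \in faces
}.

Definition faces_of_facets (n : nat) (L : seq (seq nat)) : {set {set 'I_n}} :=
  [set s : {set 'I_n} | has (fun F => [forall v in s, val v \in F]) L]%SET.

Lemma faces_of_facets_closed (n : nat) (L : seq (seq nat)) (s t : {set 'I_n}) :
  t \subset s -> s \in faces_of_facets n L -> t \in faces_of_facets n L.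
Proof.
move=> /fintype.subsetP ts; rewrite !inE => /hasP[F LF /forall_inP sF].
by apply/hasP; exists F => //; apply/forall_inP => v /ts /sF.
Qed.

Definition complex_of_facets (n : nat) (L : seq (seq nat)) :=
  SimplicialComplex (@faces_of_facets_closed n L).

(* The antipodal quotient of the boundary of the icosahedron: 0 is a pair of
   opposite vertices, and 1, ..., 5 are the other pairs, in cyclic order around
   it. *)
Definition RP2_6 : simplicial_complex 6 := complex_of_facets 6
  ([:: [:: 0; 1; 2]; [:: 0; 2; 3]; [:: 0; 3; 4]; [:: 0; 4; 5]; [:: 0; 1; 5];
      [:: 1; 2; 4]; [:: 2; 3; 5]; [:: 1; 3; 4]; [:: 2; 4; 5]; [:: 1; 3; 5]])%N.

(* Kuehnel's 36 facets, with the vertices 1, ..., 9 of Kuehnel and Banchoff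
   (The 9-vertex complex projective plane, 1983) renumbered 0, ..., 8. *)
Definition CP2_9 : simplicial_complex 9 := complex_of_facets 9
  ([:: [:: 0; 1; 3; 4; 5]; [:: 3; 4; 6; 7; 8]; [:: 0; 1; 2; 6; 7];
      [:: 1; 2; 3; 4; 5]; [:: 4; 5; 6; 7; 8]; [:: 0; 1; 2; 7; 8];
      [:: 0; 2; 3; 4; 5]; [:: 3; 5; 6; 7; 8]; [:: 0; 1; 2; 6; 8];
      [:: 0; 1; 3; 4; 8]; [:: 2; 3; 4; 6; 7]; [:: 0; 1; 5; 6; 7];
      [:: 1; 2; 4; 5; 6]; [:: 0; 4; 5; 7; 8]; [:: 1; 2; 3; 7; 8];
      [:: 0; 2; 3; 5; 7]; [:: 1; 3; 5; 6; 8]; [:: 0; 2; 4; 6; 8];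
      [:: 1; 2; 3; 5; 8]; [:: 2; 4; 5; 6; 8]; [:: 0; 2; 5; 7; 8];
      [:: 0; 2; 3; 4; 6]; [:: 0; 3; 5; 6; 7]; [:: 0; 1; 3; 6; 8];
      [:: 0; 1; 4; 5; 7]; [:: 1; 3; 4; 7; 8]; [:: 1; 2; 4; 6; 7];
      [:: 0; 2; 4; 5; 8]; [:: 2; 3; 5; 7; 8]; [:: 1; 2; 5; 6; 8];
      [:: 0; 1; 3; 5; 6]; [:: 0; 3; 4; 6; 8]; [:: 0; 2; 3; 6; 7];
      [:: 1; 2; 3; 4; 7]; [:: 1; 4; 5; 6; 7]; [:: 0; 1; 4; 7; 8]])%N.

(* Barycentric coordinates; the complex is finite, so the subspace topology of
   R^n is the usual topology of the realization. *)
Definition realization (R : realType) (n : nat) (K : simplicial_complex n) :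
    set 'rV[R]_n :=
  [set x | [/\ forall i, 0 <= x 0 i, \sum_i x 0 i = 1 &
               [set i | x 0 i != 0]%SET \in faces K]].

Arguments realization R {n} K.

Definition cell (R : realType) (n : nat) (K : simplicial_complex n)
    (s : {set 'I_n}) : set (realization R K) :=
  [set x : realization R K | forall i, (val x : 'rV[R]_n) 0 i != 0 -> i \in s].

Arguments cell R {n} K s.

Definition AEmb (R : realType) (n : nat) (K : simplicial_complex n) (d : nat) :
    set {compact-open, realization R K -> 'rV[R]_d} :=
  [set f | continuous (f : realization R K -> 'rV[R]_d) /\
     forall s t : {set 'I_n}, s \in faces K -> t \in faces K ->
       [disjoint s & t]%bool -> f @` cell R K s `&` f @` cell R K t = set0].

Arguments AEmb R {n} K d.

Definition homotopic_through (R : realType) (X Y : topologicalType)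
    (P : set (X -> Y)) (f g : X -> Y) : Prop :=
  exists H : R -> X -> Y,
    [/\ {within `[0, 1] `*` setT, continuous (fun p : R * X => H p.1 p.2)},
        H 0 = f, H 1 = g & forall t, t \in `[0, 1] -> P (H t)].

Definition reflection (R : realType) (d : nat) (x : 'rV[R]_d) : 'rV[R]_d :=
  \row_j (if val j == 0%N then - x 0 j else x 0 j).

Definition homeomorphism (X Y : topologicalType) (h : X -> Y) : Prop :=
  continuous h /\ exists g : Y -> X, [/\ continuous g, cancel h g & cancel g h].

(* [h] has local degree -1 at the origin: degrees of self-maps of
   R^d \ {0} ~ S^(d-1) are taken in [S^(d-1), S^(d-1)] = Z, where the class of
   degree -1 is that of a reflection. *)
Definition orientation_reversing (R : realType) (d : nat)
    (h : 'rV[R]_d -> 'rV[R]_d) : Prop :=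
  homeomorphism h /\
  homotopic_through R
    (fun k : [set~ (0 : 'rV[R]_d)] -> 'rV[R]_d => forall x, k x != 0)
    (fun x => h (val x) - h 0) (fun x => reflection (val x)).

Definition mirror_image (R : realType) (X : Type) (d : nat)
    (f g : X -> 'rV[R]_d) : Prop :=
  exists h, orientation_reversing h /\ g = h \o f.

Record Z2space := Z2Space {
  Z2carrier :> topologicalType;
  Z2gen : Z2carrier -> Z2carrier;
  Z2gen_continuous : continuous Z2gen;
  Z2genK : involutive Z2gen
}.

Definition Z2map (X Y : Z2space) (phi : X -> Y) : Prop :=
  continuous phi /\ forall x, phi (Z2gen x) = Z2gen (phi x).

(* The unit sphere S^(n-1) of R^n; it is empty for n = 0. *)
Definition unit_sphere (R : realType) (n : nat) : set 'rV[R]_n :=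
  [set x | \sum_i x 0 i ^+ 2 = 1].

Arguments unit_sphere R n : clear implicits.

Lemma continuous_row (R : realType) (X : topologicalType) (d : nat)
    (f : X -> 'rV[R]_d) :
  (forall j, continuous (fun x => f x 0 j)) -> continuous f.
Proof.
move=> cf x A [P nP sPA].
have : \forall y \near x, forall j, P 0 j (f y 0 j).
  by apply: filter_forall => j; apply: cf; exact: nP.
by apply: filterS => y Py; apply: sPA => i j; rewrite ord1.
Qed.

Lemma unit_sphereN (R : realType) (n : nat) (x : unit_sphere R n) :
  - val x \in unit_sphere R n.
Proof.
have x1 : unit_sphere R n (val x) by exact: set_valP.
rewrite inE; apply: etrans x1.
by apply: eq_bigr => i _; rewrite mxE sqrrN.
Qed.

Definition antipode (R : realType) (n : nat) (x : unit_sphere R n) :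
  unit_sphere R n := exist _ (- val x) (unit_sphereN x).

Lemma antipode_continuous (R : realType) (n : nat) :
  continuous (@antipode R n).
Proof.
apply: (@continuous_comp_initial _ _ _ set_val).
apply: continuous_row => j x.
rewrite (_ : (fun _ => _) = (fun y : unit_sphere R n => - (val y : 'rV[R]_n) 0 j)); last first.
  by apply/funext => y; rewrite /= mxE.
apply: (@continuous_comp _ _ _ (fun y : unit_sphere R n => (val y : 'rV[R]_n) 0 j) -%R).
  apply: (@continuous_comp _ _ _ (fun y : unit_sphere R n => set_val y)
    (fun M : 'rV[R]_n => M 0 j)).
    exact: initial_continuous.
  exact: coord_continuous.
exact: opp_continuous.
Qed.

Lemma antipodeK (R : realType) (n : nat) : involutive (@antipode R n).
Proof. by move=> x; apply: val_inj; rewrite /= opprK. Qed.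

Definition sphere_Z2 (R : realType) (n : nat) : Z2space :=
  Z2Space (@antipode_continuous R n) (@antipodeK R n).

Lemma reflection_continuous (R : realType) (d : nat) :
  continuous (@reflection R d).
Proof.
apply: continuous_row => j x.
rewrite (_ : (fun _ => _) =
    (fun y : 'rV[R]_d => if val j == 0%N then - y 0 j else y 0 j)); last first.
  by apply/funext => y; rewrite mxE.
case: eqP => _; last exact: coord_continuous.
apply: (@continuous_comp _ _ _ (fun y : 'rV[R]_d => y 0 j) -%R).
  exact: coord_continuous.
exact: opp_continuous.
Qed.

Lemma reflectionK (R : realType) (d : nat) : involutive (@reflection R d).
Proof.
by move=> x; apply/rowP => j; rewrite !mxE; case: eqP => // _; rewrite opprK.
Qed.

Lemma AEmb_reflection (R : realType) (n : nat) (K : simplicial_complex n)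
    (d : nat) (f : AEmb R K d) :
  (@reflection R d \o val f : {compact-open, realization R K -> 'rV[R]_d})
    \in AEmb R K d.
Proof.
have [cf df] := set_valP f; rewrite inE; split.
  move=> x; apply: (@continuous_comp _ _ _ (val f : realization R K -> 'rV[R]_d)).
    exact: cf.
  exact: reflection_continuous.
move=> s t sK tK /(df s t sK tK) st0.
rewrite -!(image_comp (val f) (@reflection R d)) -subset0.
move=> _ [[_ [x sx <-] <-] [_ [y ty <-] /(can_inj (@reflectionK R d)) xy]].
suff : set0 (val f x : 'rV[R]_d) by [].
by rewrite -st0; split; [exists x | exists y].
Qed.

Definition AEmb_gen (R : realType) (n : nat) (K : simplicial_complex n)
    (d : nat) (f : AEmb R K d) : AEmb R K d :=
  exist _ (@reflection R d \o val f) (AEmb_reflection f).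

Lemma AEmb_gen_continuous (R : realType) (n : nat) (K : simplicial_complex n)
    (d : nat) : continuous (@AEmb_gen R n K d).
Proof.
apply: (@continuous_comp_initial _ _ _ set_val).
move=> f; apply: (iffRL (compact_open_cvgP _ _)).
  by have FF := @fmap_filter _ _ (set_val \o @AEmb_gen R n K d) (nbhs f)
    (nbhs_filter f).
move=> C O cC oO fCO.
pose O' := @reflection R d @^-1` O.
have oO' : open O'.
  by apply: open_comp oO => x _; exact: reflection_continuous.
have nf : nbhs (set_val f) [set g : {compact-open, realization R K -> 'rV[R]_d} |
    g @` C `<=` O'].
  apply: open_nbhs_nbhs; split; first exact: compact_open_open.
  by move=> _ [x Cx <-]; apply: fCO; exists x.
have nf' := @initial_continuous (AEmb R K d) _ set_val f _ nf.
apply: (@filterS _ _ (nbhs_filter f) _ _ _ nf') => g gC _ [x Cx <-].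
by apply: gC; exists x.
Qed.

Lemma AEmb_genK (R : realType) (n : nat) (K : simplicial_complex n) (d : nat) :
  involutive (@AEmb_gen R n K d).
Proof.
by move=> f; apply: val_inj; apply/funext => x; rewrite /= reflectionK.
Qed.

Definition AEmb1 (R : realType) (n : nat) (K : simplicial_complex n) (d : nat) :
    Z2space :=
  Z2Space (@AEmb_gen_continuous R n K d) (@AEmb_genK R n K d).

Arguments AEmb1 R {n} K d.

(* The sphere in R^n is S^(n-1), which accounts for the shift; S^(-1) is empty,
   so that -1 is always a lower bound. *)
Definition is_coind (R : realType) (Y : Z2space) (k : int) : Prop :=
  let sphere_maps n := exists phi : sphere_Z2 R n -> Y, Z2map phi in
  (exists2 n : nat, k = n%:Z - 1 & sphere_maps n) /\
  (forall n : nat, sphere_maps n -> n%:Z - 1 <= k).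

(* Main.v *)
Require Import Defs.
From mathcomp Require Import all_boot all_order all_algebra.
From mathcomp Require Import all_classical all_reals all_analysis.
From mathcomp Require Import ring lra zify.

(* Let K be one of the two complexes, with d + 2 vertices, and let an
   almost-embedding f of K into R^d be given. The vectors z of R^(d + 2) of
   l^1-norm 2 form a (d + 1)-sphere S. Since exactly one part of every
   bipartition of the vertices is a face, an odd function "balance" on S vanishes
   exactly where the supports of the positive part z+ and of the negative part z-
   are both faces; where moreover sum z_i = 0, the points z+ and z- lie in |K| and
   have disjoint supports, so f(z+) <> f(z-). Hence
     z |-> (f(z+) - f(z-), balance z, sum z_i)
   (with f extended to R^(d + 2) by Tietze's theorem) is an odd nowhere zero map
   from S to R^(d + 2), and therefore has odd degree. A homotopy from f to h o f
   through almost-embeddings, followed by h(a) - h(b) ~ h(a - b) - h(0) ~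
   reflection (a - b), shows that reflecting the first coordinate does not change
   the degree; but it changes its sign.

   The degree is a signed count of simplices with prescribed labels, the label of
   x being the position and the sign of the largest coordinate of its image, in an
   iterated barycentric subdivision of the octahedral sphere S. Chains are
   represented as functionals on cochains, i.e. on functions of lists of points,
   so that no formal sums are needed. *)

Set Implicit Arguments.
Unset Strict Implicit.
Unset Printing Implicit Defensive.

Import Order.TTheory GRing.Theory Num.Theory.
Import numFieldNormedType.Exports.

Local Open Scope classical_set_scope.
Local Open Scope ring_scope.

(** * Cochains on lists of points *)

(* A list of k + 1 points stands for a k-simplex, and the empty list for the empty
   simplex: the complexes are augmented. *)
Fixpoint cobd (T : Type) (A : zmodType) (phi : seq T -> A) (s : seq T) : A :=
  if s is x :: t then phi t - cobd (phi \o cons x) t else 0.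

Lemma eq_cobd_in (T : eqType) (A : zmodType) (phi psi : seq T -> A) s :
  (forall t, subseq t s -> size s = (size t).+1 -> phi t = psi t) ->
  cobd phi s = cobd psi s.
Proof.
elim: s phi psi => //= x s IH phi psi e.
have -> : phi s = psi s by apply: e => //; exact: subseq_cons.
rewrite (IH (phi \o cons x) (psi \o cons x))// => t ts st /=.
by apply: e; rewrite /= ?eqxx// st.
Qed.

Section Cobd.
Context {T : Type} {A : comPzRingType}.
Implicit Types (phi psi : seq T -> A) (s t : seq T).

Lemma cobdB phi psi s :
  cobd (fun t => phi t - psi t) s = cobd phi s - cobd psi s.
Proof.
elim: s phi psi => [|x s IH] phi psi /=; first by rewrite subr0.
rewrite [X in _ - _ - X](_ : _ = cobd (phi \o cons x) s - cobd (psi \o cons x) s).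
  by ring.
exact: IH.
Qed.

Lemma cobd0 s : cobd (fun=> 0 : A) s = 0.
Proof. by elim: s => //= x s; rewrite /comp => ->; rewrite subr0. Qed.

Lemma cobdK phi s : cobd (cobd phi) s = 0.
Proof.
elim: s phi => //= x s IH phi; rewrite (_ : cobd phi \o cons x =
  fun t => phi t - cobd (phi \o cons x) t) // cobdB IH subr0.
by rewrite subrr.
Qed.

Lemma cobd_map (U : Type) (f : T -> U) (phi : seq U -> A) s :
  cobd phi (map f s) = cobd (phi \o map f) s.
Proof. by elim: s phi => //= x s IH phi; rewrite IH. Qed.

Lemma cobd_raddf (B : comPzRingType) (f : {additive A -> B}) phi s :
  cobd (f \o phi) s = f (cobd phi s).
Proof.
elim: s phi => [|x s IH] phi /=; first by rewrite raddf0.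
by rewrite raddfB -IH.
Qed.

End Cobd.

Definition del (T : Type) j (s : seq T) := take j s ++ drop j.+1 s.

Lemma cobdE (T : Type) (A : pzRingType) (phi : seq T -> A) s :
  cobd phi s = \sum_(j < size s) (-1) ^+ j * phi (del j s).
Proof.
elim: s phi => [|x s IH] phi /=; first by rewrite big_ord0.
rewrite big_ord_recl /del /= drop0 expr0 mul1r IH -sumrN; congr (_ + _).
by apply: eq_bigr => j _; rewrite exprS mulN1r mulNr.
Qed.

(* The prism operator between the simplicial maps [l] and [l'], by recursion on
   the first vertex: prism (x * t) = (l x, l' x, l' t) - l x * prism t. *)
Fixpoint prism (T L : Type) (A : zmodType) (l l' : T -> L) (phi : seq L -> A)
    (s : seq T) : A :=
  if s is x :: t then
    phi [:: l x, l' x & map l' t] - prism l l' (phi \o cons (l x)) t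
  else 0.

Section Prism.
Context {T L : Type} {A : comPzRingType} (l l' : T -> L).
Implicit Types (phi psi : seq L -> A) (s : seq T).

Lemma prismB phi psi s : prism l l' (fun t => phi t - psi t) s =
  prism l l' phi s - prism l l' psi s.
Proof.
elim: s phi psi => [|x s IH] phi psi /=; first by rewrite subr0.
rewrite [X in _ - _ - X](_ : _ =
  prism l l' (phi \o cons (l x)) s - prism l l' (psi \o cons (l x)) s).
  by ring.
exact: IH.
Qed.

(** The prism is a chain homotopy; homotopy invariance of the degree rests on this identity. *)
Lemma prism_cobd phi s :
  prism l l' (cobd phi) s + cobd (prism l l' phi) s =
  phi (map l' s) - phi (map l s).
Proof.
elim: s phi => [|x s IH] phi /=; first by rewrite addr0 subrr.
rewrite (_ : cobd phi \o cons (l x) =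
  fun t => phi t - cobd (phi \o cons (l x)) t) // prismB.
rewrite (_ : prism l l' phi \o cons x = fun t =>
  (phi \o cons (l x) \o cons (l' x)) (map l' t) -
  prism l l' (phi \o cons (l x)) t) // cobdB.
rewrite (cobd_map l' (phi \o cons (l x) \o cons (l' x))).
rewrite (_ : (phi \o cons (l x)) \o cons (l' x) \o map l' =
   (fun t => phi [:: l x, l' x & map l' t])) //.
have {IH} := IH (phi \o cons (l x)); rewrite /=.
set a := prism _ _ _ _; set b := cobd (prism _ _ _) _.
set c := phi (_ :: _); set d := phi (_ :: _); set e := cobd _ s.
set f := prism _ _ _ _; set g := phi _.
move=> E; transitivity (g - c + (a + b)); first by ring.
by rewrite E; ring.
Qed.

End Prism.

(** * Barycentric subdivision *)

Section Subdivision.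
Context {R : realType} {V : normedModType R}.
Implicit Types (s t u : seq V) (P : V -> Prop) (D : R).

Definition bary s : V := (size s)%:R^-1 *: \sum_(x <- s) x.

Lemma bary_opp s : bary (map -%R s) = - bary s.
Proof. by rewrite /bary size_map big_map sumrN scalerN. Qed.

(** A discrete form of convexity: such a property passes from the vertices of a simplex to those of
    its subdivisions. *)
Definition bary_closed P := forall s, s != [::] -> {in s, forall x, P x} -> P (bary s).

Lemma bary_closed_ball c D : bary_closed (fun x => `|x - c| <= D).
Proof.
move=> s s0 sD; have k0 : 0 < (size s)%:R :> R by rewrite ltr0n lt0n size_eq0.
have -> : bary s - c = (size s)%:R^-1 *: \sum_(x <- s) (x - c).
  rewrite big_split /= scalerDr; congr (_ + _).
  rewrite big_const_seq count_predT iter_addr_0 -[(- c) *+ _]scaler_nat scalerA.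
  by rewrite mulVf ?scale1r// gt_eqF.
rewrite normrZ ger0_norm ?invr_ge0 ?(ltW k0)// mulrC ler_pdivrMr//.
rewrite (le_trans (ler_norm_sum _ _ _))// big_seq.
rewrite (le_trans (ler_sum _ sD))//.
by rewrite -big_seq big_const_seq count_predT iter_addr_0 mulr_natr.
Qed.

Definition diam_le D s := {in s &, forall x y, `|x - y| <= D}.

(** In the mean of the vectors [y - x] the term with [x = y] vanishes, which leaves the factor
    [(size s - 1) / size s], at most [n / (n + 1)]. *)
Lemma bary_dist n D s y : (size s <= n.+1)%N -> diam_le D s -> y \in s ->
  `|y - bary s| <= n%:R / n.+1%:R * D.
Proof.
move=> sn sD ys; have s0 : (0 < size s)%N by case: (s) ys.
have k0 : 0 < (size s)%:R :> R by rewrite ltr0n.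
have D0 : 0 <= D by rewrite (le_trans _ (sD _ _ ys ys)).
have -> : y - bary s = (size s)%:R^-1 *: \sum_(x <- s) (y - x).
  rewrite big_split /= scalerDr sumrN scalerN; congr (_ + _).
  rewrite big_const_seq count_predT iter_addr_0 -[y *+ _]scaler_nat scalerA.
  by rewrite mulVf ?scale1r// gt_eqF.
rewrite (perm_big _ (perm_to_rem ys)) /= big_cons subrr add0r.
rewrite normrZ ger0_norm ?invr_ge0 ?(ltW k0)// mulrC ler_pdivrMr//.
have -> : n%:R / n.+1%:R * D * (size s)%:R = D * (n%:R * (size s)%:R / n.+1%:R).
  by ring.
rewrite (le_trans (ler_norm_sum _ _ _))//.
apply: (@le_trans _ _ (D * (size s).-1%:R)).
  rewrite -(size_rem ys) -[X in X%:R](count_predT) mulr_natr -iter_addr_0.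
  rewrite -big_const_seq big_seq [leRHS]big_seq ler_sum// => x /mem_rem xs.
  exact: sD.
rewrite ler_wpM2l// ler_pdivlMr ?ltr0n// -!natrM ler_nat.
by move: s0 sn; case: (size s) => // k _ /=; lia.
Qed.

(* The transpose of the subdivision operator given by
   sd s = bary s * sd (boundary of s). *)
Fixpoint sdv (A : zmodType) k (phi : seq V -> A) s : A :=
  if k is k'.+1 then cobd (sdv k' (phi \o cons (bary s))) s else phi s.

(** The recursion of [sdv] descends to facets, each shorter by one, so the size of [s] is the depth
    required. *)
Definition sd (A : zmodType) (phi : seq V -> A) s := sdv (size s) phi s.

(** What is used of the simplices [t] in a subdivision of [s]; [P] will be a ball or a face of the
    octahedral sphere. *)
Definition refines D s t := [/\ size t = size s,
  forall P, bary_closed P -> {in s, forall x, P x} -> {in t, forall x, P x} &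
  diam_le D t].

(** Locality of subdivision. The new vertex [bary s] is close to all vertices of [s], hence also to
    those of any simplex refining a facet, because balls are closed under barycentres. *)
Lemma eq_sdv n (A : zmodType) k (phi psi : seq V -> A) s D :
  size s = k -> (k <= n.+1)%N -> diam_le D s ->
  (forall t, refines (n%:R / n.+1%:R * D) s t -> phi t = psi t) ->
  sdv k phi s = sdv k psi s.
Proof.
elim: k phi psi s => [|k IH] phi psi s.
  move=> /size0nil -> _ _ e /=; by apply: e; split.
move=> sk kn sD e /=; apply: eq_cobd_in => t ts st.
have tsub := mem_subseq ts.
have tk : size t = k by apply/eqP; rewrite -eqSS -st sk.
apply: (IH _ _ _ tk (ltnW kn)).
  by move=> x y xt yt; apply: sD; exact: tsub.
move=> u [us uP uD] /=; apply: e.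
have s0 : s != [::] by case: (s) sk.
have ub x : x \in u -> `|x - bary s| <= n%:R / n.+1%:R * D.
  apply: (uP _ (@bary_closed_ball (bary s) _)).
  by move=> y /tsub ys; apply: bary_dist; rewrite // sk.
split=> /=; first by rewrite us.
  move=> P cP sP x; rewrite inE => /predU1P[->|]; first exact: cP.
  by apply: (uP P cP) => y /tsub; exact: sP.
have D0 : 0 <= D.
  by case: (s) s0 sD => // x s' _ /(_ x x); rewrite subrr normr0 mem_head; exact.
move=> x y; rewrite !inE => /predU1P[->|xu] /predU1P[->|yu].
- by rewrite subrr normr0 mulr_ge0// divr_ge0.
- by rewrite distrC; exact: ub.
- exact: ub.
- exact: uD.
Qed.

Lemma eq_iter_sd n (A : zmodType) m (phi psi : seq V -> A) s D :
  (size s <= n.+1)%N -> diam_le D s ->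
  (forall t, refines ((n%:R / n.+1%:R) ^+ m * D) s t -> phi t = psi t) ->
  iter m (@sd A) phi s = iter m (@sd A) psi s.
Proof.
elim: m s D phi psi => [|m IH] s D phi psi sn sD e /=.
  by apply: e; rewrite expr0 mul1r.
apply: (eq_sdv (n := n) _ sn sD) => // t [ts tP tD].
apply: IH tD _; first by rewrite ts.
move=> u [us uP uD]; apply: e; split; first by rewrite us ts.
  by move=> P cP sP; apply: (uP P cP); exact: tP.
by rewrite exprSr -mulrA.
Qed.

Section Ring.
Context {A : comPzRingType}.
Implicit Types phi psi : seq V -> A.

Lemma sdvB k phi psi s :
  sdv k (fun t => phi t - psi t) s = sdv k phi s - sdv k psi s.
Proof.
elim: k phi psi s => //= k IH phi psi s; rewrite -cobdB; congr cobd.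
by apply/funext => t; rewrite -IH.
Qed.

Lemma sd_cobd phi : sd (cobd phi) = cobd (sd phi).
Proof.
apply/funext => s; rewrite /sd.
have sdv_cobd k psi t : size t = k.+1 ->
    sdv k.+1 (cobd psi) t = cobd (sdv k psi) t.
  elim: k psi t => [|k IH] psi t tk.
    case: t tk => // x [] //= _.
    by rewrite !subr0.
  (* Subtracting a double coboundary, which is 0, makes both sides coboundaries of cochains that
     agree on the facets of [t]. *)
  rewrite [LHS]/= -[RHS]subr0 -[X in _ - X](cobdK (sdv k (psi \o cons (bary t))) t).
  rewrite -cobdB; apply: eq_cobd_in => u _ tu.
  rewrite (_ : cobd psi \o _ = fun u => psi u - cobd (psi \o cons (bary t)) u)//.
  rewrite -[LHS]/(sdv k.+1 _ u) sdvB (IH (psi \o cons (bary t)))//.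
  by apply/eqP; rewrite -eqSS -tu tk.
case sk: (size s) => [|k]; first by rewrite (size0nil sk).
rewrite sdv_cobd//; apply: eq_cobd_in => t _; rewrite sk => -[<-].
by [].
Qed.

Lemma iter_sd_cobd m phi : iter m (@sd A) (cobd phi) = cobd (iter m (@sd A) phi).
Proof. by elim: m => //= m ->; rewrite sd_cobd. Qed.

Lemma iter_sdB m phi psi s : iter m (@sd A) (fun t => phi t - psi t) s =
  iter m (@sd A) phi s - iter m (@sd A) psi s.
Proof.
elim: m s => //= m IH s; rewrite /sd.
by rewrite (funext IH : iter m (@sd A) _ = _) sdvB.
Qed.

Lemma sdv_opp k phi s : sdv k (phi \o map -%R) s = sdv k phi (map -%R s).
Proof.
elim: k phi s => //= k IH phi s; rewrite cobd_map; congr cobd.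
apply/funext => t /=; rewrite -IH; congr (sdv k _ t).
by apply/funext => u /=; rewrite bary_opp.
Qed.

Lemma iter_sd_opp m phi : iter m (@sd A) (phi \o map -%R) =
  iter m (@sd A) phi \o map -%R.
Proof.
elim: m => //= m ->; apply/funext => s; rewrite /sd sdv_opp /= size_map.
by [].
Qed.

Lemma iter_sd_rmorph (B : comPzRingType) (f : {rmorphism A -> B}) m phi :
  iter m (@sd B) (f \o phi) = f \o iter m (@sd A) phi.
Proof.
elim: m phi => //= m IH phi; rewrite IH; apply/funext => s; rewrite /sd /=.
move: (size s) (iter m _ _) => k; elim: k s => // k IHk s psi /=.
rewrite -cobd_raddf; congr cobd; apply/funext => t /=.
by rewrite -IHk.
Qed.

End Ring.
End Subdivision.

(** * The octahedral sphere as a chain *)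

Section OctahedralChains.
Context {V : zmodType} {A : comPzRingType} (v : nat -> V).
Implicit Types (phi psi : seq V -> A).

(* The hemisphere of dimension k is the cone with apex [v k] over the sphere of
   dimension k - 1, which is the union of two antipodal hemispheres. *)
Fixpoint hemi k phi : A :=
  if k is k'.+1 then
    let psi := phi \o cons (v k) in
    hemi k' psi + (-1) ^+ k * hemi k' (psi \o map -%R)
  else phi [:: v 0].

(** The sign of the opposite hemisphere is the degree of the antipodal map of the k-sphere. *)
Definition sphere_chain k phi := hemi k phi + (-1) ^+ k.+1 * hemi k (phi \o map -%R).

Lemma hemiS k phi : hemi k.+1 phi = sphere_chain k (phi \o cons (v k.+1)).
Proof. by []. Qed.

Lemma hemiB k phi psi : hemi k (fun t => phi t - psi t) = hemi k phi - hemi k psi.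
Proof.
elim: k phi psi => //= k IH phi psi.
rewrite opprD addrACA -mulrBr; congr (_ + _ * _); exact: IH.
Qed.

Lemma sphere_chainB k phi psi :
  sphere_chain k (fun t => phi t - psi t) = sphere_chain k phi - sphere_chain k psi.
Proof.
by rewrite /sphere_chain opprD addrACA -mulrBr -!hemiB.
Qed.

Let comp_oppK phi : (phi \o map -%R) \o map -%R = phi.
Proof.
apply/funext => s /=; rewrite -map_comp map_id_in// => x _ /=.
exact: opprK.
Qed.

(** Dually: a hemisphere is bounded by the sphere one dimension lower, and spheres are cycles. The
    first fact gives the second in the next dimension, and the second gives the first by the cone
    formula, hence the joint induction. *)
Lemma hemi_sphere_cobd k phi :
  hemi k.+1 (cobd phi) = sphere_chain k phi /\ sphere_chain k (cobd phi) = 0.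
Proof.
have cobd_cons psi x : cobd psi \o cons x = fun t => psi t - cobd (psi \o cons x) t.
  by [].
have cobd_opp psi : cobd psi \o map -%R = cobd (psi \o map -%R).
  by apply/funext => t /=; rewrite cobd_map.
elim: k phi => [|k IH] phi; last first.
  have hz psi : hemi k.+2 (cobd psi) = sphere_chain k.+1 psi -
      sphere_chain k.+1 (cobd (psi \o cons (v k.+2))).
    by rewrite hemiS cobd_cons sphere_chainB.
  have z psi : sphere_chain k.+1 (cobd psi) = 0.
    rewrite {1}/sphere_chain cobd_opp !(IH _).1 /sphere_chain comp_oppK.
    set a := hemi _ _; set b := hemi _ _.
    rewrite [(-1) ^+ k.+2]exprS mulN1r mulNr mulrDr mulrA -expr2 sqrr_sign.
    by ring.
  by rewrite hz !z subr0.
have z psi : sphere_chain 0 (cobd psi) = 0.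
  by rewrite /sphere_chain /= subr0 expr1 mulN1r subrr.
by split; [rewrite hemiS cobd_cons sphere_chainB z subr0|exact: z].
Qed.

(** The facets of the octahedral sphere, apex first as in [hemi]; [e] selects the negated
    vertices. *)
Fixpoint octs (e : nat -> bool) k : seq V :=
  let x := if e k then - v k else v k in
  if k is k'.+1 then x :: octs e k' else [:: x].

Lemma size_octs e k : size (octs e k) = k.+1.
Proof. by elim: k => //= k ->. Qed.

Lemma eq_octs e e' k : (forall i, (i <= k)%N -> e i = e' i) -> octs e k = octs e' k.
Proof.
elim: k => [|k IH] ee /=; rewrite ee// IH// => i ik.
exact/ee/leqW.
Qed.

Lemma octs_opp e k : map -%R (octs e k) = octs (fun i => ~~ e i) k.
Proof. by elim: k => [|k IH] /=; case: (e _); rewrite /= ?opprK ?IH. Qed.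

Lemma eq_hemi k phi psi :
  (forall e, phi (octs e k) = psi (octs e k)) -> hemi k phi = hemi k psi.
Proof.
elim: k phi psi => [|k IH] phi psi e /=; first exact: (e (fun=> false)).
(* The apex of a hemisphere is never negated, so the sign pattern is extended by [false] at
   [k.+1]. *)
have ecat d : v k.+1 :: octs d k = octs (fun i => (i <= k)%N && d i) k.+1.
  by rewrite /= ltnn; congr cons; apply: eq_octs => i ->.
congr (_ + _ * _); apply: IH => d /=; first by rewrite ecat.
by rewrite octs_opp ecat.
Qed.

End OctahedralChains.

Lemma hemi_rmorph (V : zmodType) (A B : comPzRingType) (f : {rmorphism A -> B})
    (v : nat -> V) k (phi : seq V -> A) : f (hemi v k phi) = hemi v k (f \o phi).
Proof.
elim: k phi => //= k IH phi.
by rewrite rmorphD rmorphM rmorphXn rmorphN1 !IH.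
Qed.

Lemma sphere_chain_rmorph (V : zmodType) (A B : comPzRingType)
    (f : {rmorphism A -> B}) (v : nat -> V) k (phi : seq V -> A) :
  f (sphere_chain v k phi) = sphere_chain v k (f \o phi).
Proof. by rewrite rmorphD rmorphM rmorphXn rmorphN1 !hemi_rmorph. Qed.

(** * Labels and Fan's lemma *)

Section Labels.
Context {n : nat}.
Local Notation label := ('I_n.+1 * bool)%type.
Implicit Types (a c : label) (s t : seq label).

Definition lneg a : label := (a.1, ~~ a.2).

(** The hypothesis of the lemmas of Tucker and Fan: opposite labels do not occur together. Within
    such a list a label is determined by its position. *)
Definition compatible s := all (fun a => lneg a \notin s) s.

Lemma lnegK : involutive lneg.
Proof. by case=> i b; rewrite /lneg negbK. Qed.

Lemma compatible_eq s a c : compatible s -> a \in s -> c \in s -> a.1 = c.1 -> a = c.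
Proof.
move=> /allP nc as_ /nc cs; case: a c as_ cs => [i b] [j d] /= as_ cs ij.
rewrite -ij in cs *; move: cs; rewrite /lneg /=.
by case: b d as_ => -[]//= ->.
Qed.

Lemma compatible_sub s t : {subset t <= s} -> compatible s -> compatible t.
Proof. by move=> ts /allP nc; apply/allP => a /ts /nc; apply: contra => /ts. Qed.

Fixpoint alternating b s :=
  if s is a :: t then
    [&& a.2 == b, (if t is c :: _ then (a.1 < c.1)%N else true) & alternating (~~ b) t]
  else true.

Definition lcode a : nat := (a.1.*2 + a.2)%N.
Definition lle a c := (lcode a <= lcode c)%N.

Lemma lle_total : total lle. Proof. by move=> a c; exact: leq_total. Qed.
Lemma lle_trans : transitive lle. Proof. by move=> a c d; exact: leq_trans. Qed.
Lemma lle_anti : antisymmetric lle.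
Proof.
move=> [i b] [j c] /anti_leq; rewrite /lcode /= => e.
have := congr1 odd e; rewrite !oddD !odd_double /= !oddb => bc.
by move: e; rewrite bc => /addIn /double_inj /val_inj ->.
Qed.

Lemma lle_index a c : lle a c -> (a.1 <= c.1)%N.
Proof. by rewrite /lle /lcode; case: (a.2) (c.2) => -[]; lia. Qed.

Local Notation alt2 b := (fun s => (alternating b s)%:R : 'F_2).

Lemma F2_add x y : (x + y + y : 'F_2) = x.
Proof. by rewrite -addrA addrr_pchar2 ?addr0// pchar_Fp. Qed.

Lemma F2_opp x : - x = x :> 'F_2.
Proof. by rewrite -[LHS](F2_add _ x) addNr add0r. Qed.

(** The core of Fan's lemma. A nonempty alternating list has exactly one facet alternating from [b],
    obtained by removing its last or its first label according to its initial sign. A list that does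
    not alternate has none or two: those omitting one of two neighbours of equal sign. *)
Lemma cobd_alternating b s : sorted lle s -> compatible s ->
  cobd (alt2 b) s = alt2 b s + alt2 (~~ b) s.
Proof.
elim: s b => [|a s IH] b; first by move=> _ _ /=; rewrite -[LHS](F2_add _ 1) add0r.
rewrite [sorted _ _]/= => pa nc; have ss := path_sorted pa.
have ncs : compatible s by apply: compatible_sub nc => c cs; rewrite inE cs orbT.
have as_ c : c \in s -> lle a c.
  by move: pa; rewrite path_sortedE; [case/andP=> /allP h _ /h|exact: lle_trans].
rewrite [LHS]/= F2_opp.
have [ab|ab] := eqVneq a.2 b; last first.
  rewrite (_ : alt2 b \o cons a = fun=> 0); last first.
    by apply/funext => t /=; rewrite (negbTE ab).
  rewrite cobd0 addr0 /= (negbTE ab) add0r negbK (_ : a.2 == ~~ b); last first.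
    by case: (a.2) (b) ab => -[].
  case: s as_ {IH pa ss ncs} nc => // c s as_ nc.
  rewrite andTb; case: ltnP => //= ca.
  have ac : a = c.
    apply: (compatible_eq nc); rewrite ?inE ?eqxx ?orbT//.
    by apply/val_inj/eqP; rewrite eqn_leq ca lle_index// as_ ?mem_head.
  by rewrite -ac (negbTE ab).
rewrite [alternating (~~ b) _]/= ab (_ : b == ~~ b = false) ?addr0; last by case: (b).
case: s as_ IH pa ss ncs nc => [|c s] as_ IH pa ss ncs nc.
  by rewrite /= ab eqxx addr0.
have [ac|ca] := ltnP a.1 c.1.
  rewrite [RHS]/= ab eqxx ac.
  transitivity (alt2 b (c :: s) + cobd (alt2 (~~ b)) (c :: s)); last first.
    by rewrite IH// !negbK addrC F2_add /= negbK.
  congr (_ + _); apply: eq_cobd_in => t ts _ /=; rewrite ab eqxx /=.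
  case: t ts => // d t /mem_subseq /(_ d); rewrite mem_head => /(_ isT) ds.
  rewrite (leq_trans ac)//; move: ds; rewrite inE => /predU1P[->//|ds].
  move: ss => /=; rewrite path_sortedE; last exact: lle_trans.
  by case/andP=> /allP /(_ _ ds) /lle_index.
(* With a repeated first label, the two facets omitting one copy cancel, and every other facet keeps
   both copies and fails to alternate. *)
have {ca} ac : a = c.
  apply: (compatible_eq nc); rewrite ?inE ?eqxx ?orbT//.
  by apply/val_inj/eqP; rewrite eqn_leq ca lle_index// as_ ?mem_head.
rewrite -ac [cobd _ _]/= (_ : (alt2 b \o cons a) \o cons a = fun=> 0); last first.
  by apply/funext => t /=; rewrite ltnn andbF.
rewrite cobd0 subr0 /= ltnn andbF ab eqxx /=.
by rewrite -[RHS](F2_add _ (alternating b (a :: s))%:R) /= ab eqxx add0r.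
Qed.

Lemma perm_del (T : eqType) (x0 : T) j (s : seq T) : (j < size s)%N ->
  perm_eq (del j s) (rem (nth x0 s j) s).
Proof.
move=> js; rewrite -(perm_cons (nth x0 s j)).
rewrite perm_sym (perm_trans (y := s)) 1?perm_sym ?perm_to_rem ?mem_nth//.
rewrite -[X in perm_eq _ X](cat_take_drop j s) (drop_nth x0 js) perm_sym.
exact: (permEl (perm_catCA (take j s) [:: nth x0 s j] (drop j.+1 s))).
Qed.

(** Modulo 2 the signs of the coboundary disappear, and with them the order of the vertices; labels
    may thus be sorted. *)
Lemma perm_cobd (T : eqType) (phi : seq T -> 'F_2) (s t : seq T) :
  (forall u w, perm_eq u w -> phi u = phi w) -> perm_eq s t ->
  cobd phi s = cobd phi t.
Proof.
move=> phip st.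
have e u : cobd phi u = \sum_(x <- u) phi (rem x u).
  case: u => [|x0 u]; first by rewrite big_nil.
  rewrite cobdE (big_nth x0) big_mkord; apply: eq_bigr => j _.
  have -> : (-1) ^+ j = 1 :> 'F_2 by rewrite F2_opp expr1n.
  by rewrite mul1r; apply: phip; exact: perm_del.
rewrite !e (perm_big _ st); apply: eq_big_seq => x xt; apply: phip.
rewrite -(perm_cons x); apply: perm_trans (perm_trans st (perm_to_rem xt)).
by rewrite perm_sym perm_to_rem// (perm_mem st).
Qed.

Definition fan s : 'F_2 := (alternating true (sort lle s))%:R.

Lemma sort_eq s t : perm_eq s t -> sort lle s = sort lle t.
Proof. by move/perm_sortP; apply; [exact: lle_total|exact: lle_trans|exact: lle_anti]. Qed.

Lemma alternating_lneg b s : alternating b (map lneg s) = alternating (~~ b) s.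
Proof.
elim: s b => //= a s IH b; rewrite IH; congr [&& _, _ & _].
  by case: (a.2) (b) => -[].
by case: s {IH}.
Qed.

(** Sorting reduces this to [cobd_alternating]. Negation keeps a sorted compatible list sorted,
    because labels at equal positions are equal, and it exchanges the two initial signs. *)
Lemma cobd_fan s : compatible s -> cobd fan s = fan s + fan (map lneg s).
Proof.
move=> nc; have ss : sorted lle (sort lle s) by exact/sort_sorted/lle_total.
have ncs : compatible (sort lle s).
  by apply: compatible_sub nc => a; rewrite mem_sort.
have -> : fan (map lneg s) = alt2 false (sort lle s).
  rewrite /fan -[false]/(~~ true) -alternating_lneg; congr (alternating _ _)%:R.
  rewrite (sort_eq (t := map lneg (sort lle s))); last first.
    by rewrite perm_map// perm_sym perm_sort.
  apply: (sorted_sort lle_trans); rewrite sorted_map.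
  apply: (sub_in_sorted (P := mem (sort lle s)) _ _ ss); last exact/allP.
  move=> a c as_ cs ac /=; have := lle_index ac; rewrite leq_eqVlt.
  case/predU1P => [/val_inj e|]; first by rewrite (compatible_eq ncs as_ cs e) /lle /=.
  by rewrite /lle /lcode /=; case: (~~ _) (~~ _) => -[]; lia.
rewrite (perm_cobd (t := sort lle s)); last 2 first.
- by move=> u w uw; rewrite /fan (sort_eq uw).
- by rewrite perm_sym perm_sort.
rewrite -(cobd_alternating true ss ncs); apply: eq_cobd_in => t ts _.
by rewrite /fan (sorted_sort lle_trans)//; apply: subseq_sorted ts ss; exact: lle_trans.
Qed.

End Labels.

(** * Counting facets by determinants *)

Section DetCochain.
Context {n : nat}.
Local Notation label := ('I_n.+1 * bool)%type.
Implicit Types (a c : label) (s t : seq label).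

Let a0 : label := (ord0, false).

(** The antisymmetrized product of the functions [f l]; only the first [k] entries of [s] enter,
    with [a0] as filler for shorter lists. *)
Definition detc k (f : 'I_k -> label -> int) s : int :=
  \det (\matrix_(j < k, l < k) f l (nth a0 s j)).

(** Laplace expansion along the added column of ones is the alternating sum over deleted rows. *)
Lemma detc_cobd k (f : 'I_k -> label -> int) s : size s = k.+1 ->
  detc (fun l a => if unlift ord0 l is Some l' then f l' a else 1) s =
  cobd (detc f) s.
Proof.
move=> sk; rewrite /detc (expand_det_col _ ord0) cobdE sk.
apply: eq_bigr => j _; rewrite mxE unlift_none mul1r /cofactor addn0.
congr (_ * \det _); apply/matrixP => i l; rewrite !mxE liftK; congr (f l _).
rewrite /del nth_cat size_take sk ltn_ord /=; case: ltnP => ij.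
  by rewrite nth_take// /bump leqNgt ij.
by rewrite nth_drop /bump ij addSn subnKC.
Qed.

(** By compatibility, equal positions carry equal labels, so two rows coincide. *)
Lemma detc_dup k (f : 'I_k -> label -> int) s : compatible s -> size s = k ->
  ~~ uniq (map fst s) -> detc f s = 0.
Proof.
move=> nc sk /(uniqPn ord0)[i [j [ij]]]; rewrite size_map => js.
have is_ := ltn_trans ij js.
rewrite !(nth_map a0)// => /(compatible_eq nc (mem_nth _ is_) (mem_nth _ js)) e.
rewrite sk in is_ js.
apply: (@determinant_alternate _ _ _ (Ordinal is_) (Ordinal js)).
  by rewrite -val_eqE /= ltn_eqF.
by move=> l; rewrite !mxE /= e.
Qed.

Lemma detc_notin k (f : 'I_k -> label -> int) s l :
  (forall j, (j < k)%N -> f l (nth a0 s j) = 0) -> detc f s = 0.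
Proof.
move=> z; rewrite /detc (expand_det_col _ l) big1// => j _.
by rewrite mxE z ?mul0r.
Qed.

(** For injective [F] and [n + 1] labels: the sign of the permutation if [s] rearranges the values
    of [F], and 0 otherwise. *)
Definition facet_count (F : 'I_n.+1 -> label) s : int :=
  detc (fun l a => (a == F l)%:R) s.

(** Among [n + 2] labels two share one of the [n + 1] positions, so the determinant with the added
    column of ones vanishes. *)
Lemma cobd_facet_count F s : compatible s -> size s = n.+2 ->
  cobd (facet_count F) s = 0.
Proof.
move=> nc sn; rewrite -detc_cobd// detc_dup//; apply/negP => /card_uniqP.
rewrite size_map sn => e; have := max_card (mem (map fst s)).
by rewrite e card_ord ltnn.
Qed.

(** The signs alternate, so that modulo 2 the signed count becomes Fan's count of alternating
    simplices. *)
Definition facet (l : 'I_n.+1) : label := (l, ~~ odd l).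
Definition lflip a : label := if a.1 == ord0 then lneg a else a.

(** The two determinants differ only in column 0, and the sum of these columns marks the rows of
    position 0. When positions are distinct, a row of any other position has cofactor 0, since its
    position cannot occur again. The column may therefore be filled with ones, and [detc_cobd]
    applies. *)
Lemma facet_count_flip s : compatible s -> size s = n.+1 ->
  facet_count facet s + facet_count facet (map lflip s) =
  cobd (detc (fun l a => (a == facet (lift ord0 l))%:R)) s.
Proof.
move=> nc sn; rewrite -detc_cobd//.
have -> : facet_count facet (map lflip s) =
    detc (fun l a => (lflip a == facet l)%:R) s.
  congr (\det _); apply/matrixP => j l; rewrite !mxE (nth_map a0)//.
  by rewrite sn.
have [u|u] := boolP (uniq (map fst s)); last first.
  by rewrite /facet_count !detc_dup ?addr0.
rewrite /facet_count /detc !(expand_det_col _ ord0) -big_split /=.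
apply: eq_bigr => j _; rewrite !mxE unlift_none mul1r.
set c := cofactor _ _ _; set c' := cofactor _ _ _; set c'' := cofactor _ _ _.
have [<- ->] : c = c' /\ c'' = c.
  split; congr (_ * \det _); apply/matrixP => i l; rewrite !mxE; last first.
    by rewrite liftK.
  by rewrite /lflip; case: ifP => // /eqP e; rewrite /lneg !eqE /= e !eqE /=.
rewrite -mulrDl; set a := nth _ _ _.
have [ej|] := eqVneq a.1 ord0.
  rewrite /lflip ej eqxx /facet /=; case: a ej => i b /= ->.
  by rewrite !xpair_eqE eqxx /=; case: b; rewrite ?mul1r.
rewrite eq_sym => /unlift_some[l el _]; suff -> : c = 0 by rewrite mulr0.
rewrite /c /cofactor (expand_det_col _ l) big1 ?mulr0// => i _; rewrite !mxE -el.
case: eqP => [e|_]; last by rewrite mul0r.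
have : nth ord0 (map fst s) (lift j i) == nth ord0 (map fst s) j.
  by rewrite !(nth_map a0) ?sn// e -[nth _ _ _]/a el.
rewrite nth_uniq ?size_map ?sn// => /eqP/val_inj/esym/eqP.
by rewrite (negbTE (neq_lift _ _)).
Qed.

Definition facets : seq label := map facet (enum 'I_n.+1).

Lemma facets_uniq : uniq facets.
Proof. by rewrite map_inj_uniq ?enum_uniq// => i j []. Qed.

Lemma lle_sorted_facets : sorted lle facets.
Proof.
rewrite sorted_map; apply: (@sub_sorted _ (relpre val ltn)).
  by move=> i j /= ij; rewrite /lle /lcode /=; move: ij; case: (~~ odd i) (~~ odd j) => -[]; lia.
by rewrite -sorted_map val_enum_ord iota_ltn_sorted.
Qed.

(** Strictly increasing positions between [i] and [n], as many as there are, leave no choice;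
    alternation then fixes the signs. *)
Lemma alternating_facets s i : (size s + i = n.+1)%N ->
  (if s is a :: _ then (i <= a.1)%N else true) ->
  alternating (~~ odd i) s = (s == map facet (drop i (enum 'I_n.+1))).
Proof.
elim: s i => [|a s IH] i.
  by rewrite add0n => -> _; rewrite drop_oversize// size_enum_ord.
rewrite /= addSnnS => si ia; have i_n : (i < n.+1)%N by rewrite -si leq_addl.
rewrite (drop_nth ord0) ?size_enum_ord//= eqseq_cons.
set o := nth _ _ _; have oi : o = i :> nat by rewrite /o nth_enum_ord.
have heads c t : c :: t = map facet (drop i.+1 (enum 'I_n.+1)) -> c.1 = i.+1 :> nat.
  have [i1|i1] := ltnP i.+1 n.+1; last by rewrite drop_oversize ?size_enum_ord.
  by rewrite (drop_nth ord0) ?size_enum_ord//= => -[-> _]; rewrite /= nth_enum_ord.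
have {}IH := IH i.+1 si; rewrite /= in IH.
apply/and3P/andP => [[/eqP b h alt]|[/eqP ea /eqP et]].
  have te : s == map facet (drop i.+1 (enum 'I_n.+1)).
    by rewrite -IH// ; case: (s) h => // c t; exact: leq_ltn_trans.
  split=> //; apply/eqP; case: a b ia h {alt} => k b /= -> ik h.
  have ok : o = k.
    apply/val_inj; rewrite /= oi; apply/eqP; rewrite eqn_leq ik /=.
    case: (s) h te si => [_ _ e|c t kc /eqP /heads ci _].
      by have := ltn_ord k; rewrite add0n in e; lia.
    by rewrite -ltnS -ci.
  by rewrite /facet -oi ok.
have -> : alternating (~~ ~~ odd i) s.
  by rewrite IH ?et//; rewrite -et; case: (s) et => // c t /heads ->.
rewrite ea /= oi; split=> //.
by case: (s) et => // c t /heads ->.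
Qed.

Lemma fanE s : size s = n.+1 -> fan s = (perm_eq s facets)%:R.
Proof.
move=> sn; rewrite /fan -[true]/(~~ odd 0) alternating_facets; last 2 first.
- by rewrite size_sort addn0.
- by case: sort.
rewrite drop0 -/facets; congr (_ : bool)%:R; apply/eqP/idP => [<-|/sort_eq ->].
  by rewrite perm_sym perm_sort.
by apply: (sorted_sort lle_trans); exact: lle_sorted_facets.
Qed.

Lemma facet_count_mod2 s : compatible s -> size s = n.+1 ->
  (facet_count facet s)%:~R = fan s.
Proof.
move=> nc sn; rewrite fanE//.
have sf : size facets = n.+1 by rewrite size_map size_enum_ord.
have [p|np] := boolP (perm_eq s facets); last first.
  suff [l ls] : exists l, facet l \notin s.
    rewrite /facet_count (@detc_notin _ _ _ l)// => j js; case: eqP => // e.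
    by move: ls; rewrite -e mem_nth// sn.
  apply/existsP; apply: contraNT np => /existsPn fs.
  have sub : {subset facets <= s}.
    by move=> _ /mapP[l _ ->]; have := fs l; rewrite negbK.
  have ss : (size s <= size facets)%N by rewrite sn sf.
  have [_ e] := uniq_min_size facets_uniq sub ss.
  rewrite perm_sym uniq_perm ?facets_uniq//.
  exact: leq_size_uniq facets_uniq sub ss.
have us : uniq s by rewrite (perm_uniq p) facets_uniq.
(* A permutation matrix: being orthogonal, it has a determinant of square 1, which is odd. *)
set M : 'M[int]_n.+1 := \matrix_(j < n.+1, l < n.+1) (nth a0 s j == facet l)%:R.
have MM : M *m M^T = 1%:M.
  apply/matrixP => j k; rewrite !mxE.
  have : nth a0 s j \in facets by rewrite -(perm_mem p) mem_nth// sn.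
  case/mapP => l _ el; rewrite (bigD1 l)//= !mxE el eqxx mul1r big1 ?addr0.
    by rewrite -el nth_uniq ?sn// eq_sym.
  move=> i il; rewrite !mxE el (_ : facet l == facet i = false) ?mul0r//.
  by apply/negP => /eqP[/esym/eqP]; rewrite (negbTE il).
have : (facet_count facet s) * (facet_count facet s) = 1.
  by rewrite -[X in _ * X]det_tr -det_mulmx MM det1.
move=> /(congr1 (fun z : int => z%:~R : 'F_2)); rewrite rmorphM /=.
move: (_%:~R) => x; case: x => -[|[|//]] ix /(congr1 val) //= _.
exact: val_inj.
Qed.

End DetCochain.

(** * Fine simplices and dominant coordinates *)

Section OctahedralSphere.
Context {R : realType} {n : nat}.
Local Notation V := 'rV[R]_n.+1.
Implicit Types (x y u w : V) (s t : seq V).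

(** With radius 2, the positive and the negative part of a point of coordinate sum 0 each have total
    mass 1. *)
Definition octahedral_sphere : set V := [set x | \sum_i `|x 0 i| = 2].

Definition vertex (k : nat) : V := \row_(i < n.+1) (2 * (k == i)%:R).

(** Linear conditions, hence preserved by barycentres. *)
Definition octahedral_face (e : nat -> bool) x :=
  (forall i : 'I_n.+1, 0 <= (-1) ^+ e i * x 0 i) /\ \sum_(i < n.+1) (-1) ^+ e i * x 0 i = 2.

Lemma octahedral_face_abs e x (i : 'I_n.+1) : octahedral_face e x ->
  `|x 0 i| = (-1) ^+ e i * x 0 i.
Proof. by move=> [/(_ i) xi _]; rewrite -(ger0_norm xi) normrMsign. Qed.

Lemma octahedral_face_sphere e x : octahedral_face e x -> octahedral_sphere x.
Proof.
move=> xe; rewrite /octahedral_sphere /= -[RHS]xe.2.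
by apply: eq_bigr => i _; rewrite (octahedral_face_abs _ xe).
Qed.

Lemma octahedral_face_norm e x : octahedral_face e x -> `|x| <= 2.
Proof.
move=> xe; rewrite [`|x|]mx_normrE; apply: bigmax_le => // -[j i] _ /=.
rewrite ord1 -(octahedral_face_sphere xe) (bigD1 i)//= lerDl.
exact: sumr_ge0.
Qed.

Lemma octahedral_face_diam e s : {in s, forall x, octahedral_face e x} ->
  diam_le 4 s.
Proof.
move=> se x y /se /octahedral_face_norm x2 /se /octahedral_face_norm y2.
by rewrite (le_trans (ler_normB _ _))//; lra.
Qed.

Lemma octahedral_face_bary e : bary_closed (octahedral_face e).
Proof.
move=> s s0 se; have k0 : 0 < (size s)%:R :> R by rewrite ltr0n lt0n size_eq0.
have be (i : 'I_n.+1) : (-1) ^+ e i * bary s 0 i =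
    (size s)%:R^-1 * \sum_(x <- s) (-1) ^+ e i * x 0 i.
  by rewrite /bary mxE summxE mulrCA mulr_sumr.
split=> [i|].
  rewrite be mulr_ge0 ?invr_ge0 ?(ltW k0)// big_seq sumr_ge0// => x /se[].
  by move=> /(_ i).
rewrite (eq_bigr _ (fun i _ => be i)) -mulr_sumr exchange_big /=.
rewrite big_seq (eq_bigr (fun=> 2)) => [|x /se[]//].
rewrite -big_seq big_const_seq count_predT iter_addr_0 -[2 *+ _]mulr_natr.
by rewrite mulrCA mulVf ?mulr1// gt_eqF.
Qed.

Lemma octs_face e k : (k <= n)%N ->
  {in octs vertex e k, forall x, octahedral_face e x}.
Proof.
have ve j : (j <= n)%N -> octahedral_face e (if e j then - vertex j else vertex j).
  move=> jn; have E (i : 'I_n.+1) : (-1) ^+ e i * (if e j then - vertex j else vertex j) 0 i =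
      2 * (j == i)%:R.
    have [->|ji] := eqVneq j i; last first.
      by case: (e j); rewrite !mxE (negbTE ji) !(mulr0, oppr0).
    by case: (e i); rewrite !mxE eqxx ?expr1 ?mulN1r ?opprK ?mul1r.
  split=> [i|]; first by rewrite E mulr_ge0.
  rewrite (eq_bigr _ (fun i _ => E i)) (bigD1 (inord j))//= inordK// eqxx mulr1.
  rewrite big1 ?addr0// => i ij; rewrite (_ : j == i = false) ?mulr0//.
  by apply: contraNF ij => /eqP ->; rewrite inord_val.
elim: k => [|k IH] kn x /=; rewrite inE; first by move=> /eqP ->; exact: ve.
by move=> /predU1P[->|]; [exact: ve|apply: IH; exact: ltnW].
Qed.

Definition fine d s := diam_le d s /\ exists e, {in s, forall x, octahedral_face e x}.

Lemma fine_opp d s : fine d s -> fine d (map -%R s).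
Proof.
move=> [sd [e se]]; split.
  move=> _ _ /mapP[x xs ->] /mapP[y ys ->].
  by rewrite -opprD normrN; exact: sd.
exists (fun i => ~~ e i) => _ /mapP[x /se[x0 x2] ->].
have E (i : 'I_n.+1) : (-1) ^+ (~~ e i) * (- x) 0 i = (-1) ^+ e i * x 0 i.
  by rewrite mxE signrN mulrNN.
by split=> [i|]; [rewrite E|rewrite (eq_bigr _ (fun i _ => E i))].
Qed.

(** After enough subdivisions only small simplices matter; [M] is uniform in the dimension, the
    coefficients and the cochains. *)
Lemma eq_hemi_sd d : 0 < d -> exists M, forall m k (A : comPzRingType)
    (phi psi : seq V -> A), (M <= m)%N -> (k <= n)%N ->
  (forall s, size s = k.+1 -> fine d s -> phi s = psi s) ->
  hemi vertex k (iter m (@sd R V A) phi) = hemi vertex k (iter m (@sd R V A) psi).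
Proof.
move=> d0; pose r : R := n%:R / n.+1%:R.
have r1 : `|r| < 1.
  by rewrite ger0_norm ?divr_ge0// ltr_pdivrMr ?ltr0n// mul1r ltr_nat.
(* Faces have diameter at most 4, so the mesh after [m] subdivisions is at most [4 * r ^+ m]. *)
have /cvgrPdist_lt/(_ (d / 4) _)[|M _ Md] := cvg_expr r1.
  by rewrite divr_gt0.
exists M => m k A phi psi Mm kn e; apply: eq_hemi => o.
have so := octs_face (e := o) kn.
apply: (eq_iter_sd (n := n)) (octahedral_face_diam so) _; first by rewrite size_octs.
move=> t [ts tP tD]; apply: e; first by rewrite ts size_octs.
split; last by exists o; apply: tP; [exact: octahedral_face_bary|exact: so].
move=> x y xt yt; apply: le_trans (tD x y xt yt) _.
have /= := Md m Mm; rewrite sub0r normrN -/r ltr_pdivlMr// => /ltW.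
by apply: le_trans; rewrite ler_wpM2r// ler_norm.
Qed.

Lemma eq_sphere_chain_sd d : 0 < d -> exists M, forall m (A : comPzRingType)
    (phi psi : seq V -> A), (M <= m)%N ->
  (forall s, size s = n.+1 -> fine d s -> phi s = psi s) ->
  sphere_chain vertex n (iter m (@sd R V A) phi) =
  sphere_chain vertex n (iter m (@sd R V A) psi).
Proof.
move=> /eq_hemi_sd[M HM]; exists M => m A phi psi Mm e.
rewrite /sphere_chain -!iter_sd_opp; congr (_ + _ * _); apply: HM => // s sn fs.
by apply: e; rewrite ?size_map//; exact: fine_opp.
Qed.

Definition dominant u : 'I_n.+1 * bool :=
  let i := odflt ord0 [pick i | `|u 0 i| == `|u|] in (i, 0 < u 0 i).

Lemma dominant_norm u : u != 0 -> `|u 0 (dominant u).1| = `|u|.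
Proof.
rewrite -normr_eq0 => /mx_norm_neq0[[j i] /= e]; rewrite /dominant.
by case: pickP => [k /eqP //|/(_ i)]; rewrite [`|u|]e (ord1 j) eqxx.
Qed.

Lemma dominant_sign u : (dominant u).2 = (0 < u 0 (dominant u).1).
Proof. by []. Qed.

Lemma dominant_neq0 u : u != 0 -> u 0 (dominant u).1 != 0.
Proof. by move=> u0; rewrite -normr_eq0 dominant_norm// normr_eq0. Qed.

Lemma dominant_opp u : u != 0 -> dominant (- u) = lneg (dominant u).
Proof.
move=> u0; have := dominant_neq0 u0; rewrite /dominant normrN.
rewrite (eq_pick (Q := fun i => `|u 0 i| == `|u|)); last first.
  by move=> i; rewrite /= mxE normrN.
set i := odflt _ _ => ui; rewrite /lneg /= mxE oppr_gt0.
by congr pair; rewrite -leNgt le_eqVlt (negbTE ui).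
Qed.

Lemma reflection_norm u : `|reflection u| = `|u|.
Proof.
rewrite ![`|_|]mx_normrE; apply: eq_bigr => i _.
by rewrite mxE (ord1 i.1); case: ifP; rewrite ?normrN.
Qed.

Lemma dominant_reflection u : u != 0 ->
  dominant (reflection u) = lflip (dominant u).
Proof.
move=> u0; have := dominant_neq0 u0; rewrite /dominant reflection_norm.
rewrite (eq_pick (Q := fun i => `|u 0 i| == `|u|)); last first.
  by move=> i; rewrite /= mxE; case: ifP; rewrite ?normrN.
set i := odflt _ _ => ui; rewrite /lflip /= mxE -val_eqE /=.
case: ifP => // _; rewrite /lneg /=.
by congr pair; rewrite oppr_gt0 -leNgt le_eqVlt (negbTE ui).
Qed.

(** Opposite labels would give [u - w] an entry of absolute value [|u| + |w|]. *)
Lemma dominant_close u w : `|u - w| < `|u| -> `|u - w| < `|w| -> u != 0 -> w != 0 ->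
  dominant u != lneg (dominant w).
Proof.
move=> du dw u0 w0; apply/eqP => e.
have e1 : (dominant u).1 = (dominant w).1 by rewrite e.
have : (0 < u 0 (dominant u).1) = ~~ (0 < w 0 (dominant w).1).
  by rewrite -!dominant_sign e.
have := dominant_norm w0; have := dominant_norm u0; rewrite e1.
set i := (dominant w).1 => uu ww uw.
have : `|(u - w) 0 i| <= `|u - w|.
  rewrite [leRHS]mx_normrE; exact: (le_bigmax _ _ (0, i)).
rewrite !mxE; move: uw ww uu du dw; case: (ltP 0 (w 0 i)) => w0i.
  move=> /negbT; rewrite -leNgt => ui; rewrite (gtr0_norm w0i) (ler0_norm ui).
  by rewrite ler0_norm; lra.
move=> ui; rewrite (ler0_norm w0i) (gtr0_norm ui).
by rewrite ger0_norm; lra.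
Qed.

(** A Lebesgue number for the labelling: [dominant_close] applies near each point, and compactness
    makes the distance uniform. *)
Lemma compact_dominant (X : pseudoMetricType R) (G : X -> V) (K : set X) :
  compact K -> continuous G -> (forall p, K p -> G p != 0) ->
  exists2 d, 0 < d & forall p q, K p -> K q -> ball p d q ->
    dominant (G p) != lneg (dominant (G q)).
Proof.
move=> cK cG G0.
have : \forall d \near 0^'+, forall p, K p -> forall q, K q -> ball p d q ->
    dominant (G p) != lneg (dominant (G q)).
  move/compact_near_coveringP: cK; apply => p0 Kp0.
  (* Vectors within a quarter of [|G p0|] of [G p0] differ by less than half of [|G p0|] and have
     norm above three quarters of it. *)
  have g0 : 0 < `|G p0| / 4 by rewrite divr_gt0// normr_gt0 G0.
  have /cvgrPdist_lt/(_ _ g0)/nbhs_ballP[e /= e0 eG] := cG p0.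
  have e20 : 0 < e / 2 by rewrite divr_gt0.
  near=> p d.
  have p0p : ball p0 (e / 2) p by near: p; exact: nbhsx_ballx.
  have de : d <= e / 2 by near: d; exact: nbhs_right_le.
  move=> q Kq /(le_ball de) pq.
  have Gq : `|G p0 - G q| < `|G p0| / 4.
    by apply: eG; rewrite (splitr e); exact: ball_triangle p0p pq.
  have Gp : `|G p0 - G p| < `|G p0| / 4.
    by apply: eG; apply: le_ball p0p; lra.
  have pq' : `|G p - G q| < `|G p0| / 4 + `|G p0| / 4.
    have -> : G p - G q = (G p0 - G q) - (G p0 - G p).
      by rewrite opprB [RHS]addrC addrA subrK.
    by rewrite (le_lt_trans (ler_normB _ _))// ltrD.
  have pG : `|G p0| <= `|G p0 - G p| + `|G p| by rewrite -{1}(subrK (G p) (G p0)) ler_normD.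
  have qG : `|G p0| <= `|G p0 - G q| + `|G q| by rewrite -{1}(subrK (G q) (G p0)) ler_normD.
  by apply: dominant_close; rewrite -?normr_gt0; lra.
move=> H; near (0 : R)^'+ => d; exists d => //.
by move=> p q Kp; move: p Kp q; near: d.
Unshelve. all: by end_near.
Qed.

End OctahedralSphere.

(** * The degree *)

Lemma compatible_map (n : nat) (T : eqType) (l l' : T -> 'I_n.+1 * bool) (s : seq T) :
  {in s &, forall x y, [/\ l x != lneg (l y), l x != lneg (l' y) &
     l' x != lneg (l' y)]} -> compatible (map l s ++ map l' s).
Proof.
move=> ll; apply/allP => a; rewrite mem_cat => aa.
have sym (b c : 'I_n.+1 * bool) : b != lneg c -> c != lneg b.
  by apply: contra => /eqP ->; rewrite lnegK.
rewrite mem_cat; apply/norP.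
by split; apply/mapP => -[y ys /esym e]; case/orP: aa => /mapP[x xs ea];
  have [h1 h2 h3] := ll x y xs ys; have [k1 k2 k3] := ll y x ys xs;
  [move: k1|move: k2|move/sym: h2|move: k3]; rewrite -ea -e ?lnegK eqxx.
Qed.

Lemma prism_eq0 (T : eqType) (L : eqType) (A : comPzRingType) (l l' : T -> L)
    (psi : seq L -> A) (s : seq T) :
  (forall t, size t = (size s).+1 -> {subset t <= map l s ++ map l' s} ->
    psi t = 0) -> prism l l' psi s = 0.
Proof.
elim: s psi => //= x s IH psi h; rewrite h; last 2 first.
- by rewrite /= size_map.
- move=> a; rewrite !inE mem_cat !inE orbCA => /or3P[->|->|->] //; rewrite ?orbT//.
rewrite sub0r IH ?oppr0// => t ts tsub /=; apply: h; first by rewrite /= ts.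
move=> a; rewrite inE => /predU1P[->|/tsub]; first by rewrite mem_head.
by rewrite inE !mem_cat inE => /orP[->|->]; rewrite ?orbT.
Qed.

Section Degree.
Context {R : realType} {n : nat}.
Local Notation V := 'rV[R]_n.+1.
Local Notation S := (@octahedral_sphere R n).
Implicit Types (x y u w : V) (s t : seq V) (G : V -> V).

Lemma octahedral_sphere_compact : compact S.
Proof.
apply: bounded_closed_compact.
  exists 2; split=> // M M2 x /= Sx; rewrite (le_trans _ (ltW M2))//.
  rewrite [`|x|]mx_normrE; apply: bigmax_le => // -[j i] _ /=.
  by rewrite ord1 -Sx (bigD1 i)//= lerDl sumr_ge0.
have -> : S = (fun x : V => \sum_i `|x 0 i|) @^-1` [set 2] by [].
apply: closed_comp; last exact: closed_eq.
move=> x _; apply: continuous_big => [|i _ y]; first exact: add_continuous.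
apply: (@continuous_comp _ _ _ (fun y : V => y 0 i) Num.norm).
  exact: coord_continuous.
exact: norm_continuous.
Qed.

(** A function of the number [m] of subdivisions; degrees are compared for all large [m]. *)
Definition degree m G : int :=
  sphere_chain (@vertex R n) n
    (iter m (@sd R V int) (facet_count (@facet n) \o map (@dominant R n \o G))).

(** For close times the labels of both maps are jointly compatible, so the coboundary of
    [facet_count] vanishes on the prism. The two counts then differ by a coboundary, which the
    sphere, a cycle, sends to 0. *)
Lemma degree_homotopy_step (H : R * V -> V) : continuous H ->
  (forall p, (`[0, 1] `*` S) p -> H p != 0) ->
  exists2 d, 0 < d & exists M, forall m a b, (M <= m)%N ->
    a \in `[0, 1] -> b \in `[0, 1] -> `|a - b| < d ->
    degree m (fun x => H (a, x)) = degree m (fun x => H (b, x)).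
Proof.
move=> cH H0; have cK : compact (`[0%R, 1%R]%classic `*` S : set (R * V)).
  by apply: compact_setX; [exact: segment_compact|exact: octahedral_sphere_compact].
have [d d0 Hd] := compact_dominant cK cH H0.
have d20 : 0 < d / 2 by rewrite divr_gt0.
have [M HM] := @eq_sphere_chain_sd R n _ d20.
exists d => //; exists M => m a b Mm a01 b01 ab; rewrite /degree.
set l := @dominant R n \o (fun x => H (a, x)).
set l' := @dominant R n \o (fun x => H (b, x)).
have fs s : fine (d / 2) s -> compatible (map l s ++ map l' s).
  move=> [sd [e se]]; apply: compatible_map => x y xs ys.
  have xy : `|x - y| < d by rewrite (le_lt_trans (sd x y xs ys))//; lra.
  have Sx := octahedral_face_sphere (se _ xs).
  have Sy := octahedral_face_sphere (se _ ys).
  split; apply: Hd => //; split; rewrite /= -?ball_normE /ball_ /= ?subrr ?normr0//.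
set phi := facet_count _.
apply/eqP; rewrite eq_sym -subr_eq0 -sphere_chainB.
rewrite (_ : (fun t => _) = iter m (@sd R V int)
  (fun t => phi (map l' t) - phi (map l t))); last first.
  by apply/funext => t; rewrite iter_sdB.
rewrite (HM _ _ _ (cobd (prism l l' phi)))//.
  by rewrite iter_sd_cobd (hemi_sphere_cobd _ _ _).2.
move=> s sn /fs cs; rewrite -prism_cobd prism_eq0 ?add0r// => t ts tsub.
apply: cobd_facet_count; first exact: compatible_sub tsub cs.
by rewrite ts sn.
Qed.

Lemma degree_homotopy (H : R * V -> V) : continuous H ->
  (forall p, (`[0, 1] `*` S) p -> H p != 0) ->
  exists M, forall m, (M <= m)%N ->
    degree m (fun x => H (0, x)) = degree m (fun x => H (1, x)).
Proof.
move=> cH H0; have [d d0 [M HM]] := degree_homotopy_step cH H0.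
(* As [r] exceeds [1 / d], the unit interval is crossed in [r] steps shorter than [d]. *)
exists M => m Mm; pose r := (Num.trunc d^-1).+1.
have r0 : 0 < r%:R :> R by rewrite ltr0n.
have rd : r%:R^-1 < d.
  rewrite -[ltRHS]invrK ltf_pV2 ?posrE ?invr_gt0//.
  by have := truncnS_gt d^-1.
have E k : (k <= r)%N ->
    degree m (fun x => H (0, x)) = degree m (fun x => H (k%:R / r%:R, x)).
  have in01 j : (j <= r)%N -> j%:R / r%:R \in `[0 : R, 1].
    move=> jr; rewrite in_itv /= divr_ge0//=.
    by rewrite ler_pdivrMr// mul1r ler_nat.
  elim: k => [|k IH] kr; first by rewrite mul0r.
  rewrite IH 1?ltnW//; apply: HM => //; [exact/in01/ltnW|exact: in01|].
  rewrite -mulrBl -natr1 opprD addrA subrr sub0r mulN1r normrN.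
  by rewrite ger0_norm ?invr_ge0// ltW.
by rewrite (E r)// mulfV// gt_eqF.
Qed.

(** By [facet_count_flip] the two counts are opposite up to a coboundary. *)
Lemma degree_reflection G : continuous G -> (forall x, S x -> G x != 0) ->
  exists M, forall m, (M <= m)%N ->
    degree m (@reflection R n.+1 \o G) = - degree m G.
Proof.
move=> cG G0; have [d d0 Hd] := compact_dominant octahedral_sphere_compact cG G0.
have d20 : 0 < d / 2 by rewrite divr_gt0.
have [M HM] := @eq_sphere_chain_sd R n _ d20; exists M => m Mm.
rewrite /degree; pose l := @dominant R n \o G.
pose psi := detc (fun (i : 'I_n) a => (a == facet (lift ord0 i))%:R).
rewrite (HM _ _ _ (fun s => cobd (psi \o map l) s - facet_count (@facet n) (map l s)))//.
  rewrite (_ : iter m _ _ = fun t => iter m (@sd R V int) (cobd (psi \o map l)) t -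
     iter m (@sd R V int) (facet_count (@facet n) \o map l) t); last first.
    by apply/funext => t; rewrite iter_sdB.
  rewrite sphere_chainB iter_sd_cobd (hemi_sphere_cobd _ _ _).2 sub0r.
  by [].
move=> s sn [sd [e se]].
have Ss x : x \in s -> S x by move=> /se; exact: octahedral_face_sphere.
transitivity (facet_count (@facet n) (map lflip (map l s))).
  congr (facet_count _ _); rewrite -map_comp; apply/eq_in_map => x /Ss /G0.
  exact: dominant_reflection.
have cs : compatible (map l s).
  apply: (@compatible_sub _ (map l s ++ map l s)).
    by move=> a; rewrite mem_cat => ->.
  apply: compatible_map => x y xs ys; split; apply: Hd; try exact: Ss;
  by rewrite -ball_normE /ball_ /= (le_lt_trans (sd x y xs ys))//; lra.
rewrite /= -cobd_map -facet_count_flip ?size_map//.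
by rewrite [X in _ = X - _]addrC addrK.
Qed.

Lemma sd_seq1 (A : comPzRingType) m (phi : seq V -> A) x :
  iter m (@sd R V A) phi [:: x] = phi [:: x].
Proof.
elim: m => //= m IH; rewrite /sd /= subr0 -[RHS]IH.
by rewrite /bary big_seq1 invr1 scale1r.
Qed.

(** Fan's lemma, by induction on the dimension: modulo 2 the count on the k-sphere is that of [phi]
    plus its antipode on a hemisphere. This sum is [cobd phi] by [cobd_fan], so the count equals the
    one on the bounding sphere. In top dimension it is the degree modulo 2. *)
Lemma degree_odd G : continuous G -> (forall x, S x -> G x != 0) ->
  (forall x, S x -> G (- x) = - G x) ->
  exists M, forall m, (M <= m)%N -> (degree m G)%:~R = 1 :> 'F_2.
Proof.
move=> cG G0 GN; have [d d0 Hd] := compact_dominant octahedral_sphere_compact cG G0.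
have d20 : 0 < d / 2 by rewrite divr_gt0.
have [M1 HM1] := @eq_sphere_chain_sd R n _ d20.
have [M2 HM2] := @eq_hemi_sd R n _ d20.
exists (maxn M1 M2) => m; rewrite geq_max => /andP[mM1 mM2].
pose l := @dominant R n \o G.
have fS s : fine (d / 2) s -> forall x, x \in s -> S x.
  by move=> [_ [e se]] x /se; exact: octahedral_face_sphere.
have fc s : fine (d / 2) s -> compatible (map l s).
  move=> fs; have Ss := fS s fs; have [sd _] := fs.
  apply: (@compatible_sub _ (map l s ++ map l s)).
    by move=> a; rewrite mem_cat => ->.
  apply: compatible_map => x y xs ys; split; apply: Hd; try exact: Ss;
  by rewrite -ball_normE /ball_ /= (le_lt_trans (sd x y xs ys))//; lra.
have lN x : S x -> l (- x) = lneg (l x).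
  by move=> Sx; rewrite /l /= GN// dominant_opp// G0.
pose phi : seq V -> 'F_2 := @fan n \o map l.
pose sdm := iter m (@sd R V 'F_2).
have chain_hemi k : sphere_chain (@vertex R n) k (sdm phi) =
    hemi (@vertex R n) k (sdm (fun s => phi s - phi (map -%R s))).
  rewrite (_ : sdm (fun s => phi s - phi (map -%R s)) =
      fun s => sdm phi s - sdm (phi \o map -%R) s).
    rewrite hemiB /sphere_chain /sdm iter_sd_opp -signr_odd; congr (_ + _).
    by case: odd; rewrite ?expr1 ?mulN1r// expr0 mul1r F2_opp.
  by apply/funext => s; rewrite /sdm iter_sdB.
have chain1 k : (k <= n)%N -> sphere_chain (@vertex R n) k (sdm phi) = 1.
  elim: k => [|k IH] kn; rewrite chain_hemi.
    have Sv : S (vertex 0).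
      apply: (@octahedral_face_sphere _ _ (fun=> false)).
      exact: (@octs_face _ _ (fun=> false) 0 kn _ (mem_head _ _)).
    (* On the 0-sphere the two points carry opposite labels, exactly one of which is positive. *)
    apply: etrans (sd_seq1 m _ (vertex 0)) _.
    rewrite -[LHS]/(fan [:: l (vertex 0)] - fan [:: l (- vertex 0)]) lN//.
    by case: (l _) => i []; rewrite /fan /= ?subr0 ?sub0r ?F2_opp.
  rewrite (HM2 m k.+1 _ _ (cobd phi))//.
    by rewrite /sdm iter_sd_cobd (hemi_sphere_cobd _ _ _).1 IH// ltnW.
  move=> s _ fs; rewrite /phi -cobd_map cobd_fan; last exact: fc.
  rewrite [LHS]/= F2_opp; congr (_ + fan _).
  by rewrite -!map_comp; apply/eq_in_map => x /(fS s fs) /lN.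
rewrite -[RHS](chain1 n)// /degree -[LHS]/((intmul 1 : {rmorphism int -> 'F_2}) _).
rewrite sphere_chain_rmorph -iter_sd_rmorph; apply: HM1 => // s sn fs.
by rewrite /= facet_count_mod2 ?size_map//; exact: fc.
Qed.

End Degree.

(** * Extending homotopies *)

Section ContinuousFunctions.
Context {X Y Z : topologicalType}.

Lemma continuous_pairing (f : X -> Y) (g : X -> Z) :
  continuous f -> continuous g -> continuous (fun x => (f x, g x)).
Proof. by move=> cf cg x; apply: cvg_pair; [exact: cf|exact: cg]. Qed.

Lemma continuous_compose (f : X -> Y) (g : Y -> Z) :
  continuous f -> continuous g -> continuous (fun x => g (f x)).
Proof. by move=> cf cg x; apply: continuous_comp; [exact: cf|exact: cg]. Qed.

Lemma continuous_fst : continuous (@fst X Y).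
Proof. by move=> p; exact: cvg_fst. Qed.

Lemma continuous_snd : continuous (@snd X Y).
Proof. by move=> p; exact: cvg_snd. Qed.

End ContinuousFunctions.

Lemma continuous_difference (R : realType) (X : topologicalType)
    (V : normedModType R) (f g : X -> V) :
  continuous f -> continuous g -> continuous (fun x => f x - g x).
Proof. by move=> cf cg x; apply: cvgB; [exact: cf|exact: cg]. Qed.

Section Extension.
Context {R : realType}.

Lemma coord_comp_continuous (X : topologicalType) (d : nat) (f : X -> 'rV[R]_d)
    (j : 'I_d) : continuous f -> continuous (fun x => f x 0 j).
Proof.
move=> cf x; apply: (@continuous_comp _ _ _ f (fun y : 'rV[R]_d => y 0 j)).
  exact: cf.
exact: coord_continuous.
Qed.

(** Passes from the subtype [A] to the ambient space, where Tietze's theorem applies; the default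
    value 0 is taken only off [A], hence off [C]. *)
Lemma within_set_val (m d : nat) (A C : set 'rV[R]_m) (H : R -> A -> 'rV[R]_d) :
  {within `[0, 1] `*` setT, continuous (fun p : R * A => H p.1 p.2)} ->
  C `<=` A -> {within `[0, 1] `*` C, continuous
    (fun p : R * 'rV[R]_m => oapp (H p.1) 0 (insub p.2))}.
Proof.
move=> /subspace_continuousP cH CA; set q := fun p : R * 'rV[R]_m => _.
have qE t x (xA : x \in A) : q (t, x) = H t (Sub x xA).
  by rewrite /q /= (@insubT _ (fun y => y \in A) A x xA).
apply/subspace_continuousP => -[t x] [/= t01 Cx].
have xA : x \in A by exact/mem_set/CA.
move=> N qN; have {}qN : nbhs (H t (Sub x xA)) N by rewrite -qE.
have [[U W] /= [tU xW] UW] := cH (t, Sub x xA) (conj t01 I) N qN.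
have [/= _ [/= [W' oW' <-] /= xW'] W'W] := xW.
exists (U, W') => /=.
  by split => //; apply: open_nbhs_nbhs.
move=> [t' x'] [/= Ut' Wx'] [/= t'01 Cx'].
have xA' : x' \in A by exact/mem_set/CA.
suff : N (q (t', x')) by []; rewrite qE.
by apply: (UW (t', Sub x' xA')) => //; split => //; apply: W'W.
Qed.

(* Tietze's theorem, applied coordinate by coordinate. *)
Lemma homotopy_extension (m d : nat) (A C : set 'rV[R]_m) (H : R -> A -> 'rV[R]_d) :
  {within `[0, 1] `*` setT, continuous (fun p : R * A => H p.1 p.2)} ->
  compact C -> C `<=` A ->
  exists2 P : R * 'rV[R]_m -> 'rV[R]_d, continuous P &
    forall t (x : A), t \in `[0, 1] -> C (val x) -> P (t, val x) = H t x.
Proof.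
move=> cH cC CA; have := within_set_val cH CA.
set q := fun p : R * 'rV[R]_m => _ => cq.
have cK : compact (`[0%R, 1%R]%classic `*` C : set (R * 'rV[R]_m)).
  by apply: compact_setX => //; exact: segment_compact.
have clK := compact_closed (@norm_hausdorff _ _) cK.
have cqj j : {within `[0, 1] `*` C, continuous (fun p => q p 0 j)}.
  by apply: (@coord_comp_continuous (subspace _)).
have /boolp.choice[g gP] (j : 'I_d) : exists gj : R * 'rV[R]_m -> R,
    continuous gj /\ {in `[0%R, 1%R]%classic `*` C, (fun p => q p 0 j) =1 gj}.
  (* The extension theorem takes a bounded function with a positive bound; compactness gives [M],
     and [|M| + 1] is positive. *)
  have [M [Mr MP]] := compact_bounded (continuous_compact (cqj j) cK).
  have M0 : 0 < `|M| + 1 by rewrite ltr_wpDl.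
  have qM p : (`[0, 1] `*` C) p -> `|q p 0 j| <= `|M| + 1.
    move=> Kp; apply: (MP (`|M| + 1)); last by exists p.
    by rewrite (le_lt_trans (ler_norm M))// ltrDl.
  have [g [qg cg _]] := @continuous_bounded_extension _ R pseudometric_normal
    _ clK (fun p => q p 0 j) _ M0 (cqj j) qM.
  by exists g.
exists (fun p => \row_j g j p).
  apply: continuous_row => j p.
  rewrite (_ : (fun _ => _) = g j); first exact: (gP j).1.
  by apply/funext => y; rewrite mxE.
move=> t x t01 Cx; apply/rowP => j; rewrite mxE -(gP j).2.
  by rewrite /q /= valK.
by rewrite inE; split.
Qed.

End Extension.

(** * The map associated with a self-dual complex *)

Section JoinMap.
Context {R : realType} {d : nat} (K : simplicial_complex d.+2).
Hypothesis selfdual : forall s : {set 'I_d.+2}, (s \in faces K) = (~: s \notin faces K).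
Local Notation V := 'rV[R]_d.+2.
Implicit Types (z : V) (A B : V -> 'rV[R]_d).

Definition pos_part z : V := \row_i Num.max (z 0 i) 0.

Lemma pos_part_continuous : continuous pos_part.
Proof.
apply: continuous_row => j z.
rewrite (_ : (fun _ => _) = (fun y : V => Num.max (y 0 j) 0)); last first.
  by apply/funext => y; rewrite mxE.
apply: (@continuous_max _ _ (fun y : V => y 0 j) (fun=> 0)).
  exact: coord_continuous.
exact: cst_continuous.
Qed.

(** The sum of the squarefree monomials of the Stanley-Reisner ideal of [K], evaluated at the
    positive part. *)
Definition nonface_mass z : R :=
  \sum_(s : {set 'I_d.+2} | s \notin faces K) \prod_(i in s) pos_part z 0 i.

Lemma nonface_mass_continuous : continuous nonface_mass.
Proof.
apply: continuous_big => [|s _]; first exact: add_continuous.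
apply: continuous_big => [|i _]; first exact: mul_continuous.
by apply: coord_comp_continuous; exact: pos_part_continuous.
Qed.

Lemma nonface_mass_eq0 z :
  (nonface_mass z == 0) = ([set i | 0 < z 0 i]%SET \in faces K).
Proof.
have pos i : (pos_part z 0 i == 0) = (z 0 i <= 0).
  by rewrite mxE; case: ltP => // zi; rewrite ?eqxx//; apply/negbTE; rewrite gt_eqF.
rewrite psumr_eq0 => [|s _]; last first.
  by apply: prodr_ge0 => i _; rewrite mxE le_max lexx orbT.
apply/allP/idP => [z0|zK s _].
  apply: contraT => zK; have /= := z0 [set i | 0 < z 0 i]%SET (mem_index_enum _).
  move=> /implyP/(_ zK)/prodf_eq0[i]; rewrite inE => zi; rewrite pos leNgt zi.
  by [].
apply/implyP => sK; apply/prodf_eq0.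
have /subsetPn[i si] : ~~ (s \subset [set i | 0 < z 0 i]%SET).
  by apply: contra sK => sz; exact: faces_closed sz zK.
by rewrite inE -leNgt => zi; exists i => //; rewrite pos.
Qed.

Definition balance z := nonface_mass z - nonface_mass (- z).

(** The two supports are disjoint, so by self-duality one of them is a face and has mass 0; equality
    of the masses makes the other a face too. *)
Lemma balance_eq0 z : balance z = 0 ->
  ([set i | 0 < z 0 i]%SET \in faces K) /\ ([set i | 0 < (- z) 0 i]%SET \in faces K).
Proof.
move=> /eqP; rewrite subr_eq0 => /eqP e.
have : ([set i | 0 < z 0 i]%SET \in faces K) || ([set i | 0 < (- z) 0 i]%SET \in faces K).
  apply: contraT; rewrite negb_or => /andP[]; rewrite selfdual negbK => zK /negP[].
  apply: faces_closed zK; apply/fintype.subsetP => i; rewrite !inE mxE oppr_gt0.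
  by move/ltW; rewrite leNgt.
by rewrite -!nonface_mass_eq0 -e orbb => /eqP ->.
Qed.

(** With [a] in front, reflecting [a] reflects the whole vector as soon as [d] is positive. *)
Definition glue (a : 'rV[R]_d) (b c : R) : V := \row_(j < d.+2)
  if insub (val j) is Some k then a 0 (k : 'I_d) else if val j == d then b else c.

Lemma glue_eq0 a b c : glue a b c = 0 -> [/\ a = 0, b = 0 & c = 0].
Proof.
move=> e; split.
- apply/rowP => k; have kd : (k < d.+2)%N by rewrite (ltn_trans (ltn_ord k)).
  have := congr1 (fun u : V => u 0 (Ordinal kd)) e.
  by rewrite !mxE /= valK.
- have := congr1 (fun u : V => u 0 (Ordinal (ltnW (ltnSn d.+1)))) e.
  by rewrite !mxE /= insubF ?ltnn// eqxx.
- have := congr1 (fun u : V => u 0 ord_max) e.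
  by rewrite !mxE /= insubF ?gtn_eqF// ltnNge leqnSn.
Qed.

Lemma glueN a b c : glue (- a) (- b) (- c) = - glue a b c.
Proof.
by apply/rowP => j; rewrite !mxE; case: insubP => [k _ _|_]; [rewrite mxE|case: ifP].
Qed.

Lemma glue_reflection a b c : (0 < d)%N ->
  glue (reflection a) b c = reflection (glue a b c).
Proof.
move=> d0; apply/rowP => j; rewrite !mxE; case: insubP => [k _ kj|].
  by rewrite mxE /= kj.
by rewrite -leqNgt; case: (val j) => //; rewrite leqNgt d0.
Qed.

Lemma glue_continuous (X : topologicalType) (a : X -> 'rV[R]_d) (b c : X -> R) :
  continuous a -> continuous b -> continuous c ->
  continuous (fun x => glue (a x) (b x) (c x)).
Proof.
move=> ca cb cc; apply: continuous_row => j.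
rewrite (_ : (fun _ => _) = (fun x => if insub (val j) is Some k then a x 0 (k : 'I_d)
    else if val j == d then b x else c x)); last first.
  by apply/funext => x; rewrite mxE.
case: insub => [k|]; first exact: coord_comp_continuous.
by case: (val j == d).
Qed.

Definition balanced : set V :=
  [set z | [/\ octahedral_sphere z, balance z = 0 & \sum_i z 0 i = 0]].

Lemma balance_continuous : continuous balance.
Proof.
move=> z; apply: (@continuousB _ _ _ nonface_mass (nonface_mass \o -%R)).
  exact: nonface_mass_continuous.
apply: continuous_comp; first exact: opp_continuous.
exact: nonface_mass_continuous.
Qed.

Lemma sum_coord_continuous m : continuous (fun z : 'rV[R]_m => \sum_i z 0 i).
Proof.
apply: continuous_big => [|i _]; first exact: add_continuous.
exact: coord_continuous.
Qed.

Lemma balanced_compact : compact balanced.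
Proof.
have -> : balanced = octahedral_sphere `&`
    (balance @^-1` [set 0] `&` (fun z : V => \sum_i z 0 i) @^-1` [set 0]).
  by apply/seteqP; split => z; [case|case=> ? []].
apply: compact_closedI; first exact: octahedral_sphere_compact.
apply: closedI; apply: closed_comp; try exact: closed_eq.
  by move=> z _; exact: balance_continuous.
by move=> z _; exact: sum_coord_continuous.
Qed.

Lemma balanced_opp z : balanced z -> balanced (- z).
Proof.
move=> [Sz bz sz]; split.
- by apply: etrans Sz; apply: eq_bigr => i _; rewrite mxE normrN.
- by rewrite /balance opprK -opprB -/(balance z) bz oppr0.
- apply: etrans (_ : - \sum_i z 0 i = 0); last by rewrite sz oppr0.
  by rewrite -sumrN; apply: eq_bigr => i _; rewrite mxE.
Qed.

Lemma pos_part_supp z : [set i | pos_part z 0 i != 0]%SET = [set i | 0 < z 0 i]%SET.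
Proof.
apply/setP => i; rewrite !inE mxE; case: ltP => zi; last by rewrite eqxx.
by rewrite gt_eqF.
Qed.

Lemma balanced_realization z : balanced z -> realization R K (pos_part z).
Proof.
move=> [Sz /balance_eq0[zK _] sz]; split.
- by move=> i; rewrite mxE le_max lexx orbT.
(* Twice the positive part of a number is its absolute value plus itself, and these sum to 2 and
   0. *)
- apply: (@mulfI _ 2) => //; rewrite mulr1 mulr_sumr.
  apply: (@etrans _ _ (\sum_i (`|z 0 i| + z 0 i))); last first.
    by rewrite big_split /= sz addr0; exact: Sz.
  apply: eq_bigr => i _; rewrite mxE.
  have [zi|zi] := ltP 0 (z 0 i).
    by rewrite gtr0_norm//; ring.
  by rewrite ler0_norm//; ring.
- by rewrite pos_part_supp.
Qed.

Definition join_map A z : V := glue (A z) (balance z) (\sum_i z 0 i).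

Lemma join_map_neq0 A z : (forall z, balanced z -> A z != 0) ->
  octahedral_sphere z -> join_map A z != 0.
Proof.
move=> A0 Sz; apply/eqP => /glue_eq0[Az bz sz].
by have /eqP := A0 z (And3 Sz bz sz).
Qed.

Definition same_degree (G G' : V -> V) :=
  exists M, forall m, (M <= m)%N -> degree m G = degree m G'.

Lemma same_degree_trans G1 G2 G3 :
  same_degree G1 G2 -> same_degree G2 G3 -> same_degree G1 G3.
Proof.
move=> [M H] [M' H']; exists (maxn M M') => m; rewrite geq_max => /andP[Mm M'm].
by rewrite H// H'.
Qed.

Lemma join_map_homotopy (A : R * V -> 'rV[R]_d) : continuous A ->
  (forall t z, t \in `[0, 1] -> balanced z -> A (t, z) != 0) ->
  same_degree (join_map (fun z => A (0, z))) (join_map (fun z => A (1, z))).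
Proof.
move=> cA A0; apply: (degree_homotopy (H := fun p => join_map (fun z => A (p.1, z)) p.2)).
  apply: glue_continuous.
  - rewrite (_ : (fun _ => _) = A)//.
    by apply/funext => -[].
  - move=> p; apply: (@continuous_comp _ _ _ snd balance); first exact: cvg_snd.
    exact: balance_continuous.
  - move=> p; apply: (@continuous_comp _ _ _ snd (fun z : V => \sum_i z 0 i)).
      exact: cvg_snd.
    exact: sum_coord_continuous.
move=> [t z] [/= t01 Sz]; apply: join_map_neq0 => // w bw.
exact: A0.
Qed.

(** The straight-line homotopy is constant at balanced points, and only there can the join map
    vanish. *)
Lemma join_map_eq A B : continuous A -> continuous B ->
  (forall z, balanced z -> A z = B z) -> (forall z, balanced z -> A z != 0) ->
  same_degree (join_map A) (join_map B).
Proof.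
move=> cA cB AB A0.
pose H (p : R * V) := A p.2 + p.1 *: (B p.2 - A p.2).
have -> : A = fun z => H (0, z) by apply/funext => z; rewrite /H scale0r addr0.
have -> : B = fun z => H (1, z).
  by apply/funext => z; rewrite /H scale1r addrC subrK.
have csnd (C : V -> 'rV[R]_d) : continuous C -> continuous (fun p : R * V => C p.2).
  by move=> cC p; apply: (@continuous_comp _ _ _ snd C); [exact: cvg_snd|exact: cC].
apply: join_map_homotopy => [p|t z _ bz]; last by rewrite /H -AB// subrr scaler0 addr0 A0.
apply: cvgD; first exact: (csnd A).
apply: cvgZ; first exact: cvg_fst.
by apply: cvgB; [exact: (csnd B)|exact: (csnd A)].
Qed.

(** The degree is odd, yet equality with its negative would make it 0. *)
Lemma join_map_reflection A : (0 < d)%N -> continuous A ->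
  (forall z, A (- z) = - A z) -> (forall z, balanced z -> A z != 0) ->
  ~ same_degree (join_map A) (join_map (@reflection R d \o A)).
Proof.
move=> d0 cA AN A0 [M0 H0].
have cG : continuous (join_map A).
  apply: glue_continuous => //; first exact: balance_continuous.
  exact: sum_coord_continuous.
have G0 := fun z => @join_map_neq0 A z A0.
have GN z : octahedral_sphere z -> join_map A (- z) = - join_map A z.
  move=> _; rewrite /join_map AN -glueN /balance opprK opprB.
  by congr glue; rewrite -sumrN; apply: eq_bigr => i _; rewrite mxE.
have [M1 H1] := degree_odd cG G0 GN.
have [M2 H2] := degree_reflection cG G0.
pose m := maxn M0 (maxn M1 M2).
have := H0 m (leq_maxl _ _).
rewrite (_ : join_map (_ \o _) = @reflection R d.+2 \o join_map A); last first.
  by apply/funext => z; rewrite /join_map /= glue_reflection.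
rewrite H2 => [/eqP|]; last by rewrite /m !leq_max leqnn !orbT.
rewrite eq_sym -subr_eq0 -opprD oppr_eq0 -mulr2n mulrn_eq0 /= => /eqP e.
by have := H1 m; rewrite /m !leq_max leqnn !orbT e => /(_ isT)/eqP.
Qed.

End JoinMap.

(** * No homotopy to a mirror image *)

Section Mirror.
Context {R : realType} {d : nat} (K : simplicial_complex d.+2).
Hypothesis selfdual : forall s : {set 'I_d.+2}, (s \in faces K) = (~: s \notin faces K).
Local Notation V := 'rV[R]_d.+2.

Lemma realization_compact : compact (realization R K).
Proof.
apply: bounded_closed_compact.
  exists 1; split=> // M M1 x [x0 x1 _] /=; rewrite (le_trans _ (ltW M1))//.
  rewrite [`|x|]mx_normrE; apply: bigmax_le => // -[j i] _ /=.
  by rewrite ord1 ger0_norm// -x1 (bigD1 i)//= lerDl sumr_ge0.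
(* For nonnegative vectors, being supported on a face is the closed condition
   [nonface_mass x = 0]. *)
have -> : realization R K = \bigcap_(i in [set: 'I_d.+2]) (fun x : V => x 0 i) @^-1` [set y | 0 <= y]
    `&` ((fun x : V => \sum_i x 0 i) @^-1` [set 1] `&`
         @nonface_mass R d K @^-1` [set 0]).
  apply/seteqP; split => x.
    move=> [x0 x1 xK]; split; first by move=> i _; exact: x0.
    split=> //; apply/eqP; rewrite nonface_mass_eq0.
    by apply: faces_closed xK; apply/fintype.subsetP => i; rewrite !inE; apply: lt0r_neq0.
  move=> [x0 [x1 /eqP]]; rewrite nonface_mass_eq0 => xK.
  split=> // [i|]; first exact: x0.
  apply: faces_closed xK; apply/fintype.subsetP => i; rewrite !inE => xi.
  by rewrite lt0r xi; exact: x0.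
apply: closedI.
  apply: closed_bigI => i _; apply: closed_comp; last exact: closed_ge.
  by move=> x _; exact: coord_continuous.
apply: closedI; apply: closed_comp; try exact: closed_eq.
  by move=> z _; exact: sum_coord_continuous.
by move=> z _; exact: nonface_mass_continuous.
Qed.

Lemma AEmb_balanced (f : realization R K -> 'rV[R]_d) (z : V) (x y : realization R K) :
  AEmb R K d f -> balanced K z -> val x = pos_part z -> val y = pos_part (- z) ->
  f x != f y.
Proof.
move=> [_ df] bz xz yz; apply/eqP => fxy.
have [_ /(balance_eq0 selfdual)[sK tK] _] := bz.
have st : [disjoint [set i | 0 < z 0 i]%SET & [set i | 0 < (- z) 0 i]%SET]%bool.
  rewrite disjoint_subset; apply/fintype.subsetP => i; rewrite !inE mxE oppr_gt0.
  by move=> /ltW; rewrite leNgt.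
suff : set0 (f x) by [].
rewrite -(df _ _ sK tK st); split; [exists x => //|exists y => //].
  by move=> i; rewrite xz -pos_part_supp inE.
by move=> i; rewrite yz -pos_part_supp inE.
Qed.

(** Three homotopies [A1], [A2], [A3] lead from [f(z+) - f(z-)] to its reflection. Their ends need
    agree only at balanced points, where [join_map_eq] connects them. *)
Theorem no_homotopy_to_mirror (f g : realization R K -> 'rV[R]_d) : (0 < d)%N ->
  AEmb R K d f -> mirror_image f g -> ~ homotopic_through R (AEmb R K d) f g.
Proof.
move=> d0 fE [h [[[ch [h' [_ hK _]]] [L [cL L0 L1 Lnz]]] ->]] [H [cH H0 H1 HE]].
have [P cP PH] := homotopy_extension cH realization_compact (@subset_refl _ _).
have cP' (q : V -> V) t : continuous q -> continuous (fun z => P (t, q z)).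
  by move=> cq; apply: continuous_compose cP; apply: continuous_pairing cq; exact: cst_continuous.
have cposN : continuous (fun z : V => pos_part (- z)).
  by apply: continuous_compose pos_part_continuous; exact: opp_continuous.
pose pt z (bz : balanced K z) : realization R K :=
  exist _ (pos_part z) (mem_set (balanced_realization selfdual bz)).
have Ppt t z (bz : balanced K z) : t \in `[0, 1] -> P (t, pos_part z) = H t (pt z bz).
  move=> t01; rewrite -PH//; exact: (balanced_realization selfdual bz).
pose a z := P (0, pos_part z); pose b z := P (0, pos_part (- z)).
have t0 : (0 : R) \in `[0, 1] by rewrite in_itv /= lexx ler01.
have t1 : (1 : R) \in `[0, 1] by rewrite in_itv /= lexx ler01.
pose A1 (p : R * V) := P (p.1, pos_part p.2) - P (p.1, pos_part (- p.2)).
have A1nz t z : t \in `[0, 1] -> balanced K z -> A1 (t, z) != 0.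
  move=> t01 bz; have bNz := balanced_opp bz; rewrite /A1 /= subr_eq0.
  by rewrite (Ppt _ _ bz t01) (Ppt _ _ bNz t01); exact: (AEmb_balanced (HE t t01) bz).
have cA1 : continuous A1.
  have cq (q : V -> V) : continuous q -> continuous (fun p : R * V => P (p.1, q p.2)).
    move=> cq; apply: continuous_compose cP; apply: continuous_pairing.
      exact: continuous_fst.
    exact: continuous_compose continuous_snd cq.
  by move=> p; apply: cvgB; [exact: (cq _ pos_part_continuous)|exact: (cq _ cposN)].
pose A0 z := A1 (0, z).
have fixc (B : R * V -> 'rV[R]_d) t : continuous B -> continuous (fun z => B (t, z)).
  move=> cB; apply: continuous_compose cB; apply: continuous_pairing.
    exact: cst_continuous.
  by move=> z; exact: cvg_id.
have cA0 : continuous A0 := fixc A1 0 cA1.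
have ab z : balanced K z -> a z != b z.
  by move=> /(A1nz 0 z t0); rewrite subr_eq0.
(* From [h a - h b] to [h (a - b) - h 0]: the two arguments of [h] always differ by [a - b], so
   injectivity keeps [A2] nonzero. *)
pose A2 (p : R * V) := h (a p.2 - p.1 *: b p.2) - h ((1 - p.1) *: b p.2).
have hinj := can_inj hK.
have A2nz t z : t \in `[0, 1] -> balanced K z -> A2 (t, z) != 0.
  move=> _ /ab abz; rewrite /A2 /= subr_eq0; apply: contra abz => /eqP/hinj.
  rewrite scalerBl scale1r => /eqP; rewrite subr_eq addrNK => /eqP ->.
  by [].
have csnd (C : V -> 'rV[R]_d) : continuous C -> continuous (fun p : R * V => C p.2).
  by move=> cC; exact: continuous_compose continuous_snd cC.
have ca := csnd _ (cP' _ 0 pos_part_continuous).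
have cb := csnd _ (cP' _ 0 cposN).
have cA2 : continuous A2.
  have c1 : continuous (fun p : R * V => a p.2 - p.1 *: b p.2).
    move=> p; apply: cvgB; first exact: ca.
    by apply: cvgZ; [exact: cvg_fst|exact: cb].
  have c2 : continuous (fun p : R * V => (1 - p.1) *: b p.2).
    move=> p; apply: cvgZ; last exact: cb.
    by apply: cvgB; [exact: cvg_cst|exact: cvg_fst].
  by move=> p; apply: cvgB; [exact: (continuous_compose c1 ch)|exact: (continuous_compose c2 ch)].
(* [L] lives off the origin; the differences [A0 z] at balanced points form a compact set avoiding
   it, from which [L] is extended. *)
have cC : compact (A0 @` balanced K).
  by apply: continuous_compact; [exact: continuous_subspaceT|exact: balanced_compact].
have [|Q cQ QL] := homotopy_extension cL cC.
  by move=> _ [z bz <-] /=; apply/eqP; exact: A1nz.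
pose A3 (p : R * V) := Q (p.1, A0 p.2).
have cA3 : continuous A3.
  apply: continuous_compose cQ; apply: continuous_pairing (csnd _ cA0).
  exact: continuous_fst.
have A3E t z (bz : balanced K z) : t \in `[0, 1] ->
    exists2 w : [set~ (0 : 'rV[R]_d)], val w = A0 z & A3 (t, z) = L t w.
  move=> t01; have nz : A0 z \in [set~ (0 : 'rV[R]_d)].
    by rewrite inE /=; apply/eqP; exact: A1nz.
  exists (exist (fun u => u \in [set~ (0 : 'rV[R]_d)]) (A0 z) nz) => //.
  by rewrite -QL//; exists z.
have A3nz t z : t \in `[0, 1] -> balanced K z -> A3 (t, z) != 0.
  by move=> t01 bz; have [w _ ->] := A3E t z bz t01; exact: Lnz.
have A0N z : A0 (- z) = - A0 z by rewrite /A0 /A1 /= opprK opprB.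
have := join_map_reflection d0 cA0 A0N (fun z => A1nz 0 z t0); apply.
apply: same_degree_trans (join_map_homotopy cA1 A1nz) _.
apply: same_degree_trans (_ : same_degree _ (join_map K (fun z => A2 (0, z)))) _.
  apply: join_map_eq (fixc _ _ cA1) (fixc _ _ cA2) _ (fun z => A1nz 1 z t1) => //.
  move=> z bz; have bNz := balanced_opp bz; rewrite /A1 /A2 /a /b /=.
  rewrite scale0r !subr0 scale1r !(Ppt _ _ bz)// !(Ppt _ _ bNz)//.
  by rewrite H0 H1.
apply: same_degree_trans (join_map_homotopy cA2 A2nz) _.
apply: same_degree_trans (_ : same_degree _ (join_map K (fun z => A3 (0, z)))) _.
  apply: join_map_eq (fixc _ _ cA2) (fixc _ _ cA3) _ (fun z => A2nz 1 z t1) => //.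
  move=> z bz; have [w wz ->] := A3E 0 z bz t0; rewrite L0 wz /A2 /=.
  by rewrite scale1r subrr scale0r.
apply: same_degree_trans (join_map_homotopy cA3 A3nz) _.
apply: join_map_eq (fixc _ _ cA3) _ _ (fun z => A3nz 1 z t1) => //.
  exact: continuous_compose cA0 (@reflection_continuous R d).
by move=> z bz; have [w wz ->] := A3E 1 z bz t1; rewrite L1 wz.
Qed.

End Mirror.

(** * The coindex *)

Lemma compact_set_type (X : topologicalType) (A : set X) :
  compact A -> compact [set: A].
Proof.
move=> cA F PF _.
have FA : F (set_val @^-1` A).
  by apply: (filterS _ (@filterT _ F _)) => x _; exact: set_valP.
have [p [Ap cp]] := cA (fmap (set_val : A -> X) F) (fmap_proper_filter _ PF) FA.
have pA : p \in A by exact: mem_set.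
exists (Sub p pA : A); split=> // B N FB [_ [[W oW <-] Wp] WN].
have [_ [[b Bb <-] Wb]] : ((set_val @` B) `&` W) !=set0.
  apply: cp; last exact: open_nbhs_nbhs.
  by rewrite /fmap /=; apply: filterS FB => b Bb; exists b.
by exists b; split=> //; exact: WN.
Qed.

Lemma hausdorff_set_type (X : topologicalType) (A : set X) :
  hausdorff_space X -> hausdorff_space A.
Proof.
move=> hX p q cpq; apply: val_inj; apply: (hX (val p) (val q)) => B C Bp Cq.
have [x [Bx Cx]] := cpq _ _ (@initial_continuous A X set_val p B Bp)
  (@initial_continuous A X set_val q C Cq).
by exists (set_val x).
Qed.

Section Coindex.
Context {R : realType} {d : nat} (K : simplicial_complex d.+2).
Hypothesis selfdual : forall s : {set 'I_d.+2}, (s \in faces K) = (~: s \notin faces K).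
Hypothesis d_gt0 : (0 < d)%N.

Lemma reflection_orientation_reversing : orientation_reversing (@reflection R d).
Proof.
split.
  split; first exact: reflection_continuous.
  exists (@reflection R d); split; last 2 first.
  - exact: (@reflectionK R d).
  - exact: (@reflectionK R d).
  - exact: reflection_continuous.
have r0 : reflection 0 = 0 :> 'rV[R]_d.
  by apply/rowP => j; rewrite !mxE oppr0 if_same.
exists (fun _ x => reflection (val x)); split.
- apply: continuous_subspaceT.
  apply: (continuous_compose continuous_snd
    (g := fun x : [set~ (0 : 'rV[R]_d)] => reflection (val x))).
  apply: (continuous_compose _ (@reflection_continuous R d)).
  exact: initial_continuous.
- by apply/funext => x; rewrite r0 subr0.
- by [].
- move=> t _ [x nx] /=; apply: contraTneq nx => rx; apply/negP; rewrite inE /=.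
  by apply; rewrite -(reflectionK x) rx.
Qed.

(* The vertices go to the standard basis, minus the sum of that basis, and the
   origin: [d + 2] points of R^d, any [d + 1] of which are affinely independent.
   Vertex-disjoint faces miss a vertex. *)
Definition general_position_map (x : realization R K) : 'rV[R]_d :=
  \row_j (val x 0 (widen_ord (leqW (leqnSn d)) j) - val x 0 (Ordinal (ltnW (ltnSn d.+1)))).

(** If two points have equal images, their difference is constant on the first [d + 1] vertices and
    has sum 0. It also vanishes at a vertex missed by both faces, so it is 0, against disjointness
    of the supports. *)
Lemma general_position_AEmb : AEmb R K d general_position_map.
Proof.
split.
  apply: continuous_row => j.
  rewrite (_ : (fun _ => _) = (fun x : realization R K =>
     val x 0 (widen_ord (leqW (leqnSn d)) j) - val x 0 (Ordinal (ltnW (ltnSn d.+1)))));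
    last by apply/funext => x; rewrite mxE.
  have cv i : continuous (fun x : realization R K => (val x : 'rV[R]_d.+2) 0 i).
    by apply: coord_comp_continuous; exact: initial_continuous.
  exact: continuous_difference.
move=> s t sK tK st; rewrite -subset0 => _ [[x xs <-] [y yt exy]].
have [x0 x1 _] := set_valP x; have [y0 y1 _] := set_valP y.
pose w : 'rV[R]_d.+2 := val x - val y.
pose c := w 0 (Ordinal (ltnW (ltnSn d.+1))).
have wc i : i != ord_max -> w 0 i = c.
  rewrite -val_eqE /= => id1; have : (i <= d)%N.
    by rewrite -ltnS ltn_neqAle id1 -ltnS ltn_ord.
  rewrite leq_eqVlt => /predU1P[e|ltid].
    by congr (w 0 _); apply: val_inj.
  have := congr1 (fun u : 'rV[R]_d => u 0 (Ordinal ltid)) exy; rewrite !mxE.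
  rewrite (_ : widen_ord _ _ = i); last exact: val_inj.
  by rewrite /c /w !mxE; lra.
(* Otherwise [t] would contain the complement of [s], a nonface by self-duality. *)
have [v /andP[vs vt]] : exists v, (v \notin s) && (v \notin t).
  apply/existsP; apply: contraT => /existsPn H.
  suff : ~: s \in faces K by apply: contraTT => _; rewrite -selfdual.
  apply: faces_closed tK; apply/fintype.subsetP => v; rewrite inE => vs.
  by have := H v; rewrite vs negbK.
have wv : w 0 v = 0.
  rewrite !mxE; have /eqP -> : val x 0 v == 0 by apply: contraNT vs; exact: xs.
  have /eqP -> : val y 0 v == 0 by apply: contraNT vt; exact: yt.
  by rewrite subr0.
have sw : d.+1%:R * c + w 0 ord_max = 0.
  have : \sum_i w 0 i = 0.
    rewrite (eq_bigr (fun i => val x 0 i - val y 0 i)) => [|i _]; last by rewrite !mxE.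
    by rewrite sumrB x1 y1 subrr.
  rewrite (bigD1 ord_max)//= (eq_bigr (fun=> c)) => [|i]; last exact: wc.
  by rewrite sumr_const cardC1 card_ord -[c *+ _]mulr_natl addrC.
have c0 : c = 0.
  have [vm|/wc <-//] := eqVneq v ord_max.
  move: sw; rewrite -vm wv addr0 => /eqP; rewrite mulf_eq0 pnatr_eq0 /=.
  by move=> /eqP.
have w0 i : w 0 i = 0.
  have [->|/wc ->//] := eqVneq i ord_max.
  by move: sw; rewrite c0 mulr0 add0r.
have xy i : val x 0 i = val y 0 i.
  by apply/eqP; rewrite -subr_eq0; have /eqP := w0 i; rewrite !mxE.
have [i xi] : exists i, val x 0 i != 0.
  apply/existsP; apply: contraT => /existsPn z.
  move: x1; rewrite big1 => [/esym/eqP|i _]; first by rewrite oner_eq0.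
  by have := z i; rewrite negbK => /eqP.
have := disjointFr st (xs i xi); rewrite (yt i)//.
by rewrite -xy.
Qed.

(** On a sphere of positive dimension, half a great circle joins a point to its antipode; an
    equivariant map sends it to a forbidden homotopy from an almost-embedding to its reflection. *)
Lemma sphere_maps_le1 n :
  (exists phi : sphere_Z2 R n -> AEmb1 R K d, Z2map phi) -> (n <= 1)%N.
Proof.
case: n => [|[|n]]// [phi [cphi phiN]].
pose p0 (t : R) : 'rV[R]_n.+2 := \row_i
  (if i == 0 then cos (pi * t) else if i == 1 then sin (pi * t) else 0).
have p1 t : p0 t \in unit_sphere R n.+2.
  rewrite inE /unit_sphere /= (bigD1 0)//= (bigD1 1)//= big1 ?addr0.
    by rewrite !mxE /= cos2Dsin2.
  by move=> i /andP[i0 i1]; rewrite mxE (negbTE i0) (negbTE i1) expr0n.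
pose p t : sphere_Z2 R n.+2 := exist _ (p0 t) (p1 t).
have cp : continuous p.
  apply: (@continuous_comp_initial _ _ _ set_val).
  apply: continuous_row => j.
  have cl : continuous (fun t : R => pi * t) by exact: mulrl_continuous.
  rewrite (_ : (fun _ => _) = fun t : R =>
    if j == 0 then cos (pi * t) else if j == 1 then sin (pi * t) else 0); last first.
    by apply/funext => t; rewrite /= mxE.
  case: (j == 0); first exact: continuous_compose cl (@continuous_cos R).
  case: (j == 1); first exact: continuous_compose cl (@continuous_sin R).
  exact: cst_continuous.
pose H t := val (phi (p t)) : realization R K -> 'rV[R]_d.
have HE t : AEmb R K d (H t) by exact: (set_valP (phi (p t))).
have cH : continuous (uncurry H).
  (* A path in the compact-open topology is a jointly continuous map, as the realization is compact
     and Hausdorff. *)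
  apply: continuous_uncurry.
  - move=> x _; exists setT; first by rewrite withinET; exact: filterT.
    by split; [exact/compact_set_type/realization_compact|exact: closedT].
  - exact/hausdorff_set_type/norm_hausdorff.
  - move=> t; apply: (@continuous_comp _ _ _ (phi \o p) set_val).
      by apply: continuous_comp; [exact: cp|exact: cphi].
    exact: initial_continuous.
  - by move=> t; case: (HE t).
exfalso; apply: (no_homotopy_to_mirror selfdual d_gt0 (HE 0) (g := @reflection R d \o H 0)).
  exists (@reflection R d); split=> //; exact: reflection_orientation_reversing.
exists H; split=> //.
- apply: continuous_subspaceT.
  rewrite (_ : (fun _ => _) = uncurry H)//.
  by apply/funext => -[].
- have -> : H 1 = val (phi (Z2gen (p 0))).
    congr (val (phi _)); apply: val_inj => /=; apply/rowP => i; rewrite !mxE mulr1 mulr0.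
    rewrite cospi sinpi cos0 sin0.
    by case: ifP => // _; rewrite if_same oppr0.
  by rewrite phiN.
Qed.

(** The 0-sphere, the case [n = 1], is sent to an almost-embedding and its reflection;
    [sphere_maps_le1] is the upper bound. *)
Lemma coind_AEmb1 : is_coind R (AEmb1 R K d) 0.
Proof.
split; last first.
  by move=> n /sphere_maps_le1; case: n => [|[|]].
exists 1%N; first by rewrite subrr.
pose f : AEmb1 R K d := exist (fun u => u \in AEmb R K d) general_position_map
  (mem_set general_position_AEmb).
pose phi (x : sphere_Z2 R 1) : AEmb1 R K d :=
  if 0 < (val x : 'rV[R]_1) 0 0 then f else Z2gen f.
have nz (x : sphere_Z2 R 1) : (val x : 'rV[R]_1) 0 0 != 0.
  have : unit_sphere R 1 (val x) by exact: set_valP.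
  rewrite /unit_sphere /= big_ord1 => e; apply/eqP => x0.
  by move/eqP: e; rewrite x0 expr0n /= eq_sym oner_eq0.
exists phi; split.
  move=> x U Ux; have FF := nbhs_filter x.
  have cx : continuous (fun y : sphere_Z2 R 1 => (val y : 'rV[R]_1) 0 0).
    by apply: coord_comp_continuous; exact: initial_continuous.
  suff : \forall y \near x, phi y = phi x.
    move=> h; apply: (@filterS _ (nbhs x) _ _ _ _ h) => y e.
    by suff : U (phi y) by []; rewrite e; exact: (nbhs_singleton Ux).
  have := nz x; rewrite neq_lt /phi => /orP[x0|x0].
    apply: (@filterS _ (nbhs x) _ _ _ _ (cvgr_lt _ (cx x) 0 x0)) => y y0.
    by rewrite !ltNge !ltW.
  apply: (@filterS _ (nbhs x) _ _ _ _ (cvgr_gt _ (cx x) 0 x0)) => y y0.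
  by rewrite x0 y0.
move=> x; rewrite /phi.
have -> : (0 < (val (Z2gen x) : 'rV[R]_1) 0 0) = ~~ (0 < (val x : 'rV[R]_1) 0 0).
  by rewrite /= mxE oppr_gt0 ltNge le_eqVlt eq_sym (negbTE (nz x)).
by case: (0 < _) => //; exact: (esym (AEmb_genK f)).
Qed.

End Coindex.

(** * Self-duality of the two triangulations by enumeration *)

Fixpoint bitseqs n : seq bitseq :=
  if n is n'.+1 then map (cons true) (bitseqs n') ++ map (cons false) (bitseqs n')
  else [:: [::]].

Lemma mem_bitseqs b : b \in bitseqs (size b).
Proof.
by elim: b => //= -[] b IH; rewrite mem_cat map_f ?orbT.
Qed.

Definition subfacet (L : seq (seq nat)) (b : bitseq) : bool :=
  has (fun F => all (fun i => nth false b i ==> (i \in F)) (iota 0 (size b))) L.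

(** Encoding subsets as bit sequences turns self-duality into a computable check of all [2 ^ n]
    bipartitions. *)
Lemma selfdual_facets n L :
  all (fun b => subfacet L b == ~~ subfacet L (map negb b)) (bitseqs n) ->
  forall s : {set 'I_n}, (s \in faces (complex_of_facets n L)) =
    (~: s \notin faces (complex_of_facets n L)).
Proof.
move=> /allP H s.
have E (u : {set 'I_n}) : (u \in faces (complex_of_facets n L)) =
    subfacet L [seq i \in u | i <- enum 'I_n].
  rewrite /= inE; apply: eq_has => F; rewrite size_map size_enum_ord.
  apply/forall_inP/allP => [uF i|uF v vu].
    rewrite mem_iota add0n => /= lti; have i_u := uF (Ordinal lti).
    rewrite (nth_map (Ordinal lti)) ?size_enum_ord//.
    by rewrite (nth_ord_enum _ (Ordinal lti)); exact/implyP.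
  have := uF v; rewrite mem_iota /= ltn_ord => /(_ isT).
  by rewrite (nth_map v) ?size_enum_ord// nth_ord_enum vu.
rewrite !E.
have := H [seq i \in s | i <- enum 'I_n]; rewrite -[X in bitseqs X](size_enum_ord n).
rewrite -[X in bitseqs X](size_map (fun i => i \in s)) mem_bitseqs => /(_ isT)/eqP ->.
by congr (~~ subfacet L _); rewrite -map_comp; apply: eq_map => i; rewrite /= inE.
Qed.

Lemma RP2_selfdual (s : {set 'I_6}) : (s \in faces RP2_6) = (~: s \notin faces RP2_6).
Proof. by apply: selfdual_facets; vm_compute. Qed.

Lemma CP2_selfdual (s : {set 'I_9}) : (s \in faces CP2_9) = (~: s \notin faces CP2_9).
Proof. by apply: selfdual_facets; vm_compute. Qed.

Theorem corollary1p2 (R : realType) :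
  [/\ forall f g : realization R RP2_6 -> 'rV[R]_4,
        AEmb R RP2_6 4 f -> mirror_image f g ->
        ~ homotopic_through R (AEmb R RP2_6 4) f g,
      forall f g : realization R CP2_9 -> 'rV[R]_7,
        AEmb R CP2_9 7 f -> mirror_image f g ->
        ~ homotopic_through R (AEmb R CP2_9 7) f g,
      is_coind R (AEmb1 R RP2_6 4) 0 &
      is_coind R (AEmb1 R CP2_9 7) 0].
Proof.
split.
- by move=> f g; exact: (no_homotopy_to_mirror (d := 4) RP2_selfdual).
- by move=> f g; exact: (no_homotopy_to_mirror (d := 7) CP2_selfdual).
- exact: (coind_AEmb1 (d := 4) RP2_selfdual).
- exact: (coind_AEmb1 (d := 7) CP2_selfdual).
Qed.
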